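(* Let $1<\nu<2$ and $0<\beta<1$. Then there exist $\theta\in(0,1)$ and $\alpha>1$ such that $$\nu=\alpha\theta,\qquad \beta=-\frac{\tan\frac{\pi\theta}{2}}{\tan\frac{\pi\alpha\theta}{2}},$$ and, for such $\alpha,\theta$ and with $\sigma=\left(\cos\frac{\pi\theta}{2}\right)^{1/\nu}$, for every $t>0$ the probability density function $p(x,t)$ of the stable process $S_\nu(\sigma,\beta,0;t)$ is given, for $x\in\mathbb{R}\setminus\{0\}$, by $$p(x,t)=-\frac{1}{\pi x}\sum_{k=1}^{\infty}\frac{1}{k!}\sin\left(k\pi\frac{\alpha-1}{2\alpha}\right)\Gamma\left(1+\frac{k}{\theta\alpha}\right)\left(-\frac{x}{t^{\frac{1}{\theta\alpha}}}\right)^k .$$ Moreover, the probability density function of the stable process $S_\nu(\sigma,-\beta,0;t)$, with negative skewness parameter $-\beta$, is $x\mapsto p(-x,t)$.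
   Context: For $\nu\in(0,2)$, $\nu\neq1$, $\sigma>0$ and $\beta\in[-1,1]$, $S_\nu(\sigma,\beta,0;t)$ denotes the stable process of exponent $\nu$, dispersion parameter $\sigma$, skewness parameter $\beta$ and location parameter $0$, with characteristic function $$\mathbb{E}\left[e^{i\gamma S_{\nu}(\sigma,\beta,0;t)}\right]=e^{-t\sigma^{\nu}|\gamma|^{\nu}\left(1-i\beta\operatorname{sgn}\gamma\tan\frac{\pi\nu}{2}\right)},\qquad \gamma\in\mathbb{R}.$$ *)

(* Defs.v *)
From HB Require Import structures.
From mathcomp Require Import all_boot all_order all_algebra complex.
From mathcomp Require Import all_classical all_reals all_analysis.

Set Implicit Arguments.
Unset Strict Implicit.
Unset Printing Implicit Defensive.

Import Order.TTheory GRing.Theory Num.Theory.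
Import numFieldNormedType.Exports.

Local Open Scope classical_set_scope.
Local Open Scope ring_scope.
Local Open Scope complex_scope.

Definition cexp (R : realType) (z : R[i]) : R[i] :=
  let: a +i* b := z in (expR a * cos b) +i* (expR a * sin b).

(* E[e^{i g X}]; both integrands are bounded, so the expectations are finite. *)
Definition char_fun (d : measure_display) (T : measurableType d) (R : realType)
    (P : probability T R) (X : {RV P >-> R}) (g : R) : R[i] :=
  fine ('E_P[fun w => cos (g * X w)]) +i* fine ('E_P[fun w => sin (g * X w)]).

(* Taking some A i to be the whole line gives the product rule for every
   subfamily. *)
Definition mutually_independent (d : measure_display) (T : measurableType d)
    (R : realType) (P : probability T R) (n : nat) (Z : 'I_n -> T -> R) : Prop :=
  forall A : 'I_n -> set R, (forall i, measurable (A i)) ->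
    fine (P (\bigcap_(i in [set: 'I_n]) (Z i @^-1` A i))) =
    \prod_(i < n) fine (P (Z i @^-1` A i)).

(* S_nu(sigma, beta, 0; t): a process on times t >= 0 (values of X at negative
   times are irrelevant) that starts at 0 and has independent stationary
   increments and the prescribed one-dimensional characteristic functions.
   Stochastic continuity follows from these conditions. *)
Record stable_process (d : measure_display) (T : measurableType d)
    (R : realType) (P : probability T R) (nu sigma beta : R)
    (X : R -> {RV P >-> R}) : Prop := StableProcess {
  stable_start : {ae P, forall w, X 0 w = 0};
  stable_independent_increments : forall (n : nat) (s : nat -> R),
    0 <= s 0%N -> (forall i, (i < n)%N -> s i <= s i.+1) ->
    mutually_independent P (fun i : 'I_n => X (s i.+1) \- X (s i));
  stable_stationary_increments : forall (s t : R) (A : set R),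
    0 <= s -> s <= t -> measurable A ->
    P ((X t \- X s) @^-1` A) = P (X (t - s) @^-1` A);
  stable_char_fun : forall t g : R, 0 <= t ->
    char_fun (X t) g =
    cexp (- (t * sigma `^ nu * `|g| `^ nu)%:C *
          (1 - 'i%C * (beta * Num.sg g * tan (pi * nu / 2))%:C))
}.

(* A density is only determined almost everywhere; the continuous version, when
   it exists, is unique, and pointwise formulas for "the" density refer to it. *)
Definition continuous_pdf (d : measure_display) (T : measurableType d)
    (R : realType) (P : probability T R) (X : {RV P >-> R}) (f : R -> R) : Prop :=
  [/\ continuous f,
      forall x, 0 <= f x &
      forall A : set R, measurable A ->
        distribution P X A = (\int[lebesgue_measure]_(x in A) (f x)%:E)%E].

(* Euler's integral, used at z > 0 only. *)
Definition Gamma (R : realType) (z : R) : R :=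
  (\int[lebesgue_measure]_(x in `]0%R, +oo[) (x `^ (z - 1) * expR (- x)))%R.

(* Main.v *)
Require Import Defs.
From HB Require Import structures.
From mathcomp Require Import all_boot all_order all_algebra complex.
From mathcomp Require Import all_classical all_reals all_analysis.
From mathcomp Require Import measurable_realfun ring lra.

Set Implicit Arguments.
Unset Strict Implicit.
Unset Printing Implicit Defensive.

Import Order.TTheory GRing.Theory Num.Theory.
Import numFieldNormedType.Exports.

Local Open Scope classical_set_scope.
Local Open Scope ring_scope.

(** With [phi = pi theta / 2], the characteristic function of [S_nu(sigma, beta, 0; t)]
    at [g > 0] is [exp (- t g^nu e^(i phi))], which is integrable because
    [cos phi > 0]; Fourier inversion gives the density
      [(1 / pi) \int_(g > 0) e^(- t cos phi g^nu) cos (g x + t sin phi g^nu)].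

    Inversion is obtained by Poisson smoothing: damping the inversion integral by
    [e^(- s g)] turns it into [E [s / (s^2 + (X - a)^2)]], whose integral over
    [c <= a <= e] is [E [atan ((e - X) / s) - atan ((c - X) / s)]]; as [s -> 0] this
    tends to [pi P (c < X <= e)], the law of [X] having no atoms.

    For the series, expand the cosine in powers of [x] under the integral (dominated
    by [e^(|x| g)], harmless since [nu > 1]).  The coefficients are real parts of
    [\int g^k exp (- t g^nu e^(i phi))]; rotating [phi] to [0] multiplies such an
    integral by a phase, and at [phi = 0] it is a Gamma integral. *)

(** * The half-line *)

(** The parameters are tuned so that the exponent is a pure rotation: [sigma ^ nu = cos phi], and
    the condition on [beta] amounts to [beta tan (pi nu / 2) = - tan phi], whence [sigma ^ nu (1 - i
    beta tan (pi nu / 2)) = e^(i phi)]. Changing the sign of [beta] changes that of [phi], which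
    conjugates the characteristic function and reflects the density. The ray behind the rotation has
    angle [phi / nu = pi / (2 alpha)]; this is where the sines of the series come from. The obstacle
    in the inversion is that [cos (g (X - a))] does not decay in [g] before the expectation is
    taken, so the two integrals cannot be exchanged directly. The damping supplies the missing
    majorant, and integrability of the characteristic function allows its removal by dominated
    convergence. Positivity of the smoothed kernel also shows that the density is nonnegative and
    that the law has no atoms. The rotation is carried out in real variables: the derivative in
    [phi] of the rotated integral is the integral of an [x]-derivative whose primitive vanishes at
    both ends, so the integral does not depend on [phi]. *)

Lemma cvg_Rintegral_dominated d (T : measurableType d) (R : realType)
    (mu : {measure set T -> \bar R}) (D : set T) (f_ : (T -> R)^nat)
    (f g : T -> R) :
  measurable D -> (forall n, measurable_fun D (f_ n)) -> measurable_fun D f ->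
  {ae mu, forall x, D x -> f_ n x @[n --> \oo] --> f x} ->
  mu.-integrable D (EFin \o g) -> (forall n x, D x -> `|f_ n x| <= g x) ->
  \int[mu]_(x in D) f_ n x @[n --> \oo] --> \int[mu]_(x in D) f x.
Proof.
move=> mD mf_ mf f_f ig f_g.
have [||||intf _ cvgf] := @dominated_convergence _ _ _ mu _ mD
    (fun n x => (f_ n x)%:E) (fun x => (f x)%:E) (EFin \o g) _ _ _ ig.
- by move=> n; exact/measurable_EFinP.
- exact/measurable_EFinP.
- apply: filterS f_f => x + Dx => /(_ Dx) fx.
  by apply: cvg_EFin; [exact: nearW|exact: fx].
- by apply: aeW => x n Dx; rewrite /= lee_fin f_g.
rewrite /Rintegral; apply/fine_cvg.
by rewrite fineK//; exact: integrable_fin_num.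
Qed.

Section half_line.
Context {R : realType}.
Notation mu := (@lebesgue_measure R).
Notation H := (`]0%R, +oo[%classic : set R).
Implicit Types f F : R -> R.

Lemma measurable_half_line f :
  {in `]0, +oo[, continuous f} -> measurable_fun H f.
Proof.
by move=> cf; apply: open_continuous_measurable_fun => // x /set_mem /cf.
Qed.

Lemma half_lineE (x : R) : H x <-> 0 < x.
Proof. by rewrite /= in_itv/= andbT. Qed.

Lemma cvg_Rintegral_half_line f (a b : R^nat) :
  mu.-integrable H (EFin \o f) ->
  (forall n, 0 < a n) -> a @ \oo --> 0 -> b @ \oo --> +oo ->
  \int[mu]_(x in `[a n, b n]) f x @[n --> \oo] --> \int[mu]_(x in H) f x.
Proof.
move=> intf a0 ca cb.
have mf : measurable_fun H f by apply/measurable_EFinP; exact: measurable_int intf.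
have abE n : `[a n, b n]%classic = H `&` `[a n, b n].
  apply/seteqP; split => [x /= xab|x []//]; split => //.
  rewrite in_itv/= andbT.
  by move: xab; rewrite in_itv/= => /andP[+ _]; exact: lt_le_trans.
under eq_fun do rewrite abE Rintegral_mkcondr.
refine (@cvg_Rintegral_dominated _ _ _ mu H
  (fun n => f \_ `[a n, b n]) f (fun x => `|f x|) _ _ _ _ _ _) => //.
- move=> n; apply/(measurable_restrict f) => //.
  by apply: measurable_funS mf => // x [].
- apply: aeW => x /half_lineE x0.
  apply: cvg_near_cst; near=> n.
  rewrite patchE mem_set//= in_itv/=; apply/andP; split.
    by near: n; apply: (cvgr_le _ ca) => //.
  by near: n; apply: (cvgryPge _).1.
- exact: integrable_norm.
- move=> n x Hx; rewrite patchE; case: ifP => //; rewrite normr0//.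
Unshelve. all: by end_near. Qed.

(** The shift by two, rather than one, keeps the inequality strict at [n = 0], so no truncation
    interval is degenerate. *)
Lemma invn_bounds (n : nat) : 0 < (n.+2%:R^-1 : R) < n.+2%:R.
Proof.
rewrite invr_gt0 ltr0n/=.
by rewrite (@lt_trans _ _ 1)// ?invf_lt1 ?ltr1n.
Qed.

Lemma cvg_invn : n.+2%:R^-1 @[n --> \oo] --> (0 : R).
Proof.
have := @cvg_harmonic R; rewrite -(cvg_shiftn 1).
by under eq_fun do rewrite addn1.
Qed.

Lemma cvg_natrS2 : (n.+2%:R : R) @[n --> \oo] --> +oo.
Proof.
apply/cvgryPge => A; near=> n; rewrite -addn2 natrD.
apply: (@le_trans _ _ n%:R); last by rewrite lerDl.
by near: n; exact: nbhs_infty_ger.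
Unshelve. all: by end_near. Qed.

(** Real powers are differentiated only at positive points, so the values at both ends enter as
    limits: the compact theorem is applied on [[1/(n+2), n+2]], and integrability lets the truncated
    integrals converge. *)
Lemma Rintegral_half_line_FTC f F (l0 l : R) :
  {in `]0, +oo[, continuous f} -> mu.-integrable H (EFin \o f) ->
  (forall x : R, 0 < x -> is_derive x 1 F (f x)) ->
  F x @[x --> 0^'+] --> l0 -> F x @[x --> +oo] --> l ->
  \int[mu]_(x in H) f x = l - l0.
Proof.
move=> cf intf dF F0 Fy.
pose a n : R := n.+2%:R^-1; pose b n : R := n.+2%:R.
have a0 n : 0 < a n by have /andP[] := invn_bounds n.
have ab n : a n < b n by have /andP[] := invn_bounds n.
have FE n : \int[mu]_(x in `[a n, b n]) f x = F (b n) - F (a n).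
  have sub x : x \in `[a n, b n] -> 0 < x.
    by rewrite in_itv/= => /andP[+ _]; exact: lt_le_trans.
  have cF (x : R) : 0 < x -> {for x, continuous F}.
    move=> x0; apply: differentiable_continuous; apply/derivable1_diffP.
    exact: (@ex_derive _ _ _ _ _ _ _ (dF _ x0)).
  rewrite /Rintegral (@continuous_FTC2 _ f F)//.
  - apply: continuous_in_subspaceT => x /set_mem xab.
    by apply: cf; rewrite in_itv/= andbT; exact: sub.
  - split.
    + move=> x /subset_itv_oo_cc /sub x0.
      exact: (@ex_derive _ _ _ _ _ _ _ (dF _ x0)).
    + by apply: cvg_at_right_filter; exact: cF.
    + by apply: cvg_at_left_filter; apply: cF; exact: lt_trans (ab n).
  - move=> x /subset_itv_oo_cc /sub x0.
    by rewrite derive1E; exact: (@derive_val _ _ _ _ _ _ _ (dF _ x0)).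
have := cvg_Rintegral_half_line intf a0 cvg_invn cvg_natrS2.
under eq_fun do rewrite FE.
move/cvg_lim => <- //; apply/cvg_lim => //; apply: cvgB.
  by move/cvg_pinftyP : Fy; apply; exact: cvg_natrS2.
by move/cvg_at_rightP : F0; apply; split => //; exact: cvg_invn.
Qed.

End half_line.

(** * Differentiation rules in composable form *)

Section derive_rules.
Context {R : realType}.
Implicit Types (f g : R -> R) (x a b c : R).

Lemma is_derive_mul f g x a b : is_derive x 1 f a -> is_derive x 1 g b ->
  is_derive x 1 (fun z => f z * g z) (a * g x + f x * b).
Proof.
move=> df dg; apply: (@is_derive_eq _ _ _ (f * g)).
by rewrite /= -[_ *: b]/(f x * b) -[_ *: a]/(g x * a) addrC mulrC.
Qed.

Lemma is_derive_val f x a b : is_derive x 1 f a -> a = b -> is_derive x 1 f b.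
Proof. by move=> + <-. Qed.

Lemma is_derive_add f g x a b : is_derive x 1 f a -> is_derive x 1 g b ->
  is_derive x 1 (fun z => f z + g z) (a + b).
Proof. by move=> df dg; exact: (is_deriveD df dg). Qed.

Lemma is_derive_opp f x a : is_derive x 1 f a ->
  is_derive x 1 (fun z => - f z) (- a).
Proof. by move=> df; exact: (is_deriveN df). Qed.

Lemma is_derive_chain f g x a b :
  is_derive x 1 f a -> is_derive (f x) 1 g b ->
  is_derive x 1 (fun z => g (f z)) (a * b).
Proof. by move=> df dg; rewrite mulrC; exact: (is_derive1_comp dg df). Qed.

Lemma is_derive_scale c f x a : is_derive x 1 f a ->
  is_derive x 1 (fun z => c * f z) (c * a).
Proof.
move=> df; apply: (is_derive_val (is_derive_mul (is_derive_cst c x 1) df)).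
by rewrite mul0r add0r.
Qed.

Lemma is_derive_expR_comp f x a : is_derive x 1 f a ->
  is_derive x 1 (fun z => expR (f z)) (a * expR (f x)).
Proof. by move=> df; exact: is_derive_chain. Qed.

Lemma is_derive_cos_comp f x a : is_derive x 1 f a ->
  is_derive x 1 (fun z => cos (f z)) (a * - sin (f x)).
Proof. by move=> df; exact: is_derive_chain. Qed.

Lemma is_derive_sin_comp f x a : is_derive x 1 f a ->
  is_derive x 1 (fun z => sin (f z)) (a * cos (f x)).
Proof. by move=> df; exact: is_derive_chain. Qed.

Lemma is_derive_continuous f x a : is_derive x 1 f a -> {for x, continuous f}.
Proof.
by move=> df; apply: differentiable_continuous; exact/derivable1_diffP.
Qed.

End derive_rules.

(** * The Poisson kernel as a cosine integral *)

Section poisson_kernel.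
Context {R : realType}.
Notation mu := (@lebesgue_measure R).
Notation H := (`]0%R, +oo[%classic : set R).

Lemma integrable_expRN (s : R) : 0 < s ->
  mu.-integrable H (EFin \o (fun x => expR (- (s * x)))).
Proof.
move=> s0.
have ie : mu.-integrable H (EFin \o exponential_pdf s).
  exact: (integrableS measurableT _ _ (integrable_exponential_pdf s0)).
have mH : measurable (H : set (measurableTypeR R)) by [].
have ies := integrableZl mH s^-1 ie.
apply: eq_integrable ies => // x /set_mem /half_lineE x0 /=.
by rewrite -EFinM exponential_pdfE ?ltW// mulrA mulVf ?gt_eqF// mul1r mulNr.
Qed.

Lemma cvg_expRN (s : R) : 0 < s -> expR (- (s * x)) @[x --> +oo] --> (0 : R).
Proof.
move=> s0; apply: (@cvg_comp _ _ _ (fun x => s * x) (fun x => expR (- x)) _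
  (pinfty_nbhs R)).
  exact: gt0_cvgMry.
exact: cvgr_expR.
Qed.

Lemma cvg0_bounded_mul {T : Type} (F : set_system T) {FF : Filter F}
    (f g : T -> R) (M : R) :
  f @ F --> (0 : R) -> (forall x, `|g x| <= M) ->
  (fun x => f x * g x) @ F --> (0 : R).
Proof.
move=> f0 gM.
have fM : (fun x => `|f x| * M) @ F --> (0 : R).
  have := cvgM (cvg_norm f0) (cvg_cst M (F := F)).
  by rewrite normr0 mul0r; exact.
apply/norm_cvg0P; apply: (squeeze_cvgr _ (cvg_cst 0) fM).
by apply: nearW => x; rewrite normr_ge0/= normrM ler_wpM2l.
Qed.

Lemma Rintegral_expRN_cos (s y : R) : 0 < s ->
  \int[mu]_(x in H) (expR (- (s * x)) * cos (x * y)) = s / (s ^+ 2 + y ^+ 2).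
Proof.
move=> s0; have sy0 : 0 < s ^+ 2 + y ^+ 2.
  by rewrite ltr_wpDr ?sqr_ge0// exprn_gt0.
(* The real part of [e^((- s + i y) x) / (- s + i y)]. *)
pose F x := expR (- (s * x)) *
  ((y * sin (x * y) - s * cos (x * y)) / (s ^+ 2 + y ^+ 2)).
have dxy (x : R) : is_derive x 1 (fun z => z * y) y.
  apply: (is_derive_val (is_derive_mul (is_derive_id x 1) (is_derive_cst y x 1))).
  by rewrite mul1r mulr0 addr0.
have dE (x : R) : is_derive x 1 (fun z => expR (- (s * z))) (- s * expR (- (s * x))).
  apply: (is_derive_val (is_derive_expR_comp (is_derive_opp
    (is_derive_scale s (is_derive_id x 1))))).
  by rewrite mulr1.
have dF (x : R) : is_derive x 1 F (expR (- (s * x)) * cos (x * y)).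
  apply: (is_derive_val (is_derive_mul (dE x) (is_derive_mul (is_derive_add
    (is_derive_scale y (is_derive_sin_comp (dxy x)))
    (is_derive_opp (is_derive_scale s (is_derive_cos_comp (dxy x)))))
    (is_derive_cst (s ^+ 2 + y ^+ 2)^-1 x 1)))).
  by rewrite /=; field; exact: lt0r_neq0.
have cf : continuous (fun x => expR (- (s * x)) * cos (x * y)).
  move=> z.
  exact: (is_derive_continuous (is_derive_mul (dE z) (is_derive_cos_comp (dxy z)))).
rewrite (@Rintegral_half_line_FTC _ _ F (F 0) 0); last 4 first.
- by move=> x _; exact: cf.
- apply: (le_integrable _ _ _ (integrable_expRN s0)) => //.
    apply/measurable_EFinP; apply: measurable_half_line => x _; exact: cf.
  move=> x _ /=; rewrite lee_fin normrM ler_piMr//.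
  exact: cos_max.
- by apply: cvg_at_right_filter; exact: is_derive_continuous (dF 0).
- apply: (@cvg0_bounded_mul _ _ _ _ _ ((`|y| + s) / (s ^+ 2 + y ^+ 2))).
    exact: cvg_expRN.
  move=> x; rewrite normrM normfV (gtr0_norm sy0) ler_pM2r ?invr_gt0//.
  rewrite (le_trans (ler_normB _ _))// !normrM (gtr0_norm s0).
  by rewrite lerD// ler_piMr ?(ltW s0)// ?sin_max ?cos_max.
- by rewrite /F !(mulr0, mul0r) oppr0 expR0 sin0 cos0; field; exact: lt0r_neq0.
Qed.

End poisson_kernel.

(** * Exchange of an expectation and an integral *)

Section fubini_dominated.
Context d1 d2 (T1 : measurableType d1) (T2 : measurableType d2) (R : realType).
Variables (P : probability T1 R) (m2 : {sigma_finite_measure set T2 -> \bar R}).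

(** Since [P] has mass 1, a majorant that depends on [y] alone has the same integral on the product
    as on [D]. It is applied with [y] a frequency and with [y] a point of [[c, e]]. *)
Lemma Rintegral_Fubini_dominated (D : set T2) (f : T1 -> T2 -> R) (k : T2 -> R) :
  measurable D -> measurable_fun setT (fun z : T1 * T2 => f z.1 z.2) ->
  m2.-integrable D (EFin \o k) ->
  (forall x y, D y -> `|f x y| <= k y) ->
  \int[P]_x (\int[m2]_(y in D) f x y) = \int[m2]_(y in D) (\int[P]_x f x y).
Proof.
move=> mD mf ik fk.
(* Extension by zero outside [D], so that Fubini is used on the whole product. *)
pose g (z : T1 * T2) := (f z.1 \_ D) z.2.
have mg : measurable_fun setT g.
  rewrite (_ : g = (fun z => f z.1 z.2 * \1_D z.2)); last first.
    by apply/funext => z; rewrite /g patch_indic.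
  apply: measurable_funM => //.
  apply: (measurableT_comp (f := \1_D : T2 -> R)) => //; exact: measurable_indic.
have ikD : m2.-integrable setT (EFin \o (k \_ D)).
  by have := (integrable_mkcond _ mD).1 ik; rewrite restrict_EFin.
have gk x y : `|g (x, y)| <= (k \_ D) y.
  rewrite /g /= !patchE; case: ifPn => [/set_mem|_]; last by rewrite normr0.
  exact: fk.
have k0 y : 0 <= (k \_ D) y by exact: le_trans (gk point y).
have igx x : m2.-integrable setT (EFin \o (fun y => g (x, y))).
  apply: le_integrable ikD => //.
    by apply/measurable_EFinP; exact: (measurableT_comp mg).
  by move=> y _ /=; rewrite lee_fin (ger0_norm (k0 y)).
have igy y : P.-integrable setT (EFin \o (fun x => g (x, y))).
  apply: (@le_integrable _ _ _ _ _ measurableT _ (cst ((k \_ D) y)%:E)).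
  - by apply/measurable_EFinP; exact: (measurableT_comp mg).
  - by move=> x _ /=; rewrite lee_fin (ger0_norm (k0 y)).
  - exact: finite_measure_integrable_cst.
have ig : (P \x m2)%E.-integrable setT (EFin \o g).
  apply/integrable12ltyP; first exact/measurable_EFinP.
  apply: (@le_lt_trans _ _ (\int[P]_x (\int[m2]_y ((k \_ D) y)%:E))%E).
    apply: ge0_le_integral => //.
    - by move=> x _; exact: integral_ge0.
    - apply: (@measurable_fun_fubini_tonelli_F _ _ _ _ _ m2
        (fun z => `|(g z)%:E|%E)) => //.
      by apply: measurableT_comp => //; exact/measurable_EFinP.
    - move=> x _; apply: ge0_le_integral => //.
      + by apply: measurableT_comp => //; exact: measurable_int (igx x).
      + by move: ikD => /measurable_int.
      + by move=> y _; rewrite lee_fin.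
  rewrite integral_cst//.
  rewrite [X in (_ * X)%E](_ : _ = 1%E); last exact: probability_setT.
  rewrite mule1; move/integrableP : ikD => [_].
  by under eq_integral do rewrite /= ger0_norm//.
rewrite /Rintegral; congr fine.
transitivity (\int[P]_x \int[m2]_y (g (x, y))%:E)%E.
  apply: eq_integral => x _.
  rewrite [in LHS]integral_mkcond fineK; last first.
    by rewrite (restrict_EFin (f x)); exact: integrable_fin_num (igx x).
  by rewrite (restrict_EFin (f x)).
rewrite (Fubini ig) [RHS]integral_mkcond; apply: eq_integral => y _.
rewrite patchE /g /=; case: ifPn => yD.
  under eq_integral do rewrite patchE yD.
  rewrite fineK//; have := integrable_fin_num measurableT (igy y).
  by rewrite /g /=; under eq_integral do rewrite patchE yD.
under eq_integral do rewrite patchE (negbTE yD).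
exact: integral0.
Qed.
End fubini_dominated.

(** * Fourier inversion *)

Section half_fourier.
Context {R : realType}.
Notation mu := (@lebesgue_measure R).
Notation H := (`]0%R, +oo[%classic : set R).
Implicit Types u v : R -> R.

(** For a characteristic function [u + i v], this is the real part of the integral of
    [(u + i v) e^(- i x a)] over positive frequencies. Negative frequencies contribute the
    conjugate, which is why the density is this integral divided by [pi] and not by [2 pi]. *)
Definition half_fourier (u v : R -> R) (a : R) : R :=
  \int[mu]_(x in H) (u x * cos (x * a) + v x * sin (x * a)).

Lemma norm_half_fourier_integrand u v (x a : R) :
  `|u x * cos (x * a) + v x * sin (x * a)| <= `|u x| + `|v x|.
Proof.
by rewrite (le_trans (ler_normD _ _))// !normrM lerD// ler_piMr// ?sin_max ?cos_max.
Qed.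

Variables u v : R -> R.
Hypotheses (iu : mu.-integrable H (EFin \o u)) (iv : mu.-integrable H (EFin \o v)).

Lemma integrable_half_fourier_bound :
  mu.-integrable H (EFin \o (fun x => `|u x| + `|v x|)).
Proof. exact: (integrableD _ (integrable_norm iu) (integrable_norm iv)). Qed.

Lemma integrable_half_fourier (a : R) :
  mu.-integrable H (EFin \o (fun x => u x * cos (x * a) + v x * sin (x * a))).
Proof.
have mxa : measurable_fun H (fun x : R => x * a) by exact: measurable_funM.
apply: (le_integrable _ _ _ integrable_half_fourier_bound) => //.
  apply/measurable_EFinP; apply: measurable_funD; apply: measurable_funM.
  - by apply/measurable_EFinP; exact: measurable_int iu.
  - apply: (measurableT_comp (f := cos)) => //.
    by apply: continuous_measurable_fun; exact: continuous_cos.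
  - by apply/measurable_EFinP; exact: measurable_int iv.
  - apply: (measurableT_comp (f := sin)) => //.
    by apply: continuous_measurable_fun; exact: continuous_sin.
move=> x _ /=; rewrite lee_fin (le_trans (norm_half_fourier_integrand _ _ _ _))//.
exact: ler_norm.
Qed.

Lemma norm_half_fourier_le (a : R) :
  `|half_fourier u v a| <= \int[mu]_(x in H) (`|u x| + `|v x|).
Proof.
apply: (le_trans (le_normr_Rintegral _ (integrable_half_fourier a))) => //.
apply: le_Rintegral => //.
- exact: integrable_norm (integrable_half_fourier a).
- exact: integrable_half_fourier_bound.
- by move=> x _; exact: norm_half_fourier_integrand.
Qed.

Lemma continuous_half_fourier : continuous (half_fourier u v).
Proof.
move=> a.
apply: (@continuity_under_integral _ _ _ mu
  (fun a x => u x * cos (x * a) + v x * sin (x * a)) H _ (a - 1) (a + 1) _ _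
  _ integrable_half_fourier_bound) => //.
- by move=> b _; exact: integrable_half_fourier.
- apply: aeW => x _ b _.
  have dxb := is_derive_scale x (is_derive_id b 1).
  exact: (is_derive_continuous (is_derive_add
    (is_derive_scale (u x) (is_derive_cos_comp dxb))
    (is_derive_scale (v x) (is_derive_sin_comp dxb)))).
- by move=> b _; apply: aeW => x _; exact: norm_half_fourier_integrand.
- by apply/mem_set; rewrite /= in_itv/= ltrBlDr ltrDl ltr01.
Qed.

End half_fourier.

(** * The Poisson-smoothed law *)

Section fourier_inversion.
Context d (T : measurableType d) (R : realType) (P : probability T R).
Variable X : {RV P >-> R}.
Notation mu := (@lebesgue_measure R).
Notation H := (`]0%R, +oo[%classic : set R).
Let u (g : R) : R := \int[P]_w cos (g * X w).
Let v (g : R) : R := \int[P]_w sin (g * X w).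

Lemma bounded_RV_integrable (h : T -> R) (M : R) : measurable_fun setT h ->
  (forall w, `|h w| <= M) -> P.-integrable setT (EFin \o h).
Proof.
move=> mh hM; apply: (@le_integrable _ _ _ _ _ measurableT _ (cst M%:E)).
- exact/measurable_EFinP.
- by move=> w _ /=; rewrite lee_fin (le_trans (hM w))// ler_norm.
- exact: finite_measure_integrable_cst.
Qed.

Lemma expectation_cos_shift (a g : R) :
  \int[P]_w cos (g * (X w - a)) = u g * cos (g * a) + v g * sin (g * a).
Proof.
have mgX : measurable_fun setT (fun w => g * X w) by exact: measurable_funM.
have ic : P.-integrable setT (EFin \o (fun w => cos (g * X w))).
  apply: (@bounded_RV_integrable _ 1) => [|w]; last exact: cos_max.
  apply: (measurableT_comp (f := cos)) => //.
  by apply: continuous_measurable_fun; exact: continuous_cos.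
have isn : P.-integrable setT (EFin \o (fun w => sin (g * X w))).
  apply: (@bounded_RV_integrable _ 1) => [|w]; last exact: sin_max.
  apply: (measurableT_comp (f := sin)) => //.
  by apply: continuous_measurable_fun; exact: continuous_sin.
rewrite /u /v -!RintegralZr// -RintegralD//.
- by apply: eq_Rintegral => w _; rewrite mulrBr cosB.
- exact: (integrableZr _ _ ic).
- exact: (integrableZr _ _ isn).
Qed.

(** The kernel is the damped cosine integral at [y = X w - a]; the factor [e^(- s x)], independent
    of [w], is the majorant that permits the exchange. *)
Lemma expectation_poisson_kernel (s a : R) : 0 < s ->
  \int[P]_w (s / (s ^+ 2 + (X w - a) ^+ 2)) =
  half_fourier (fun x => expR (- (s * x)) * u x) (fun x => expR (- (s * x)) * v x) a.
Proof.
move=> s0.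
under eq_Rintegral do rewrite -Rintegral_expRN_cos//.
rewrite (@Rintegral_Fubini_dominated _ _ _ _ _ P mu H
  (fun w x => expR (- (s * x)) * cos (x * (X w - a))) (fun x => expR (- (s * x)))) //.
- apply: eq_Rintegral => x _.
  rewrite RintegralZl//; last first.
    apply: (@bounded_RV_integrable _ 1) => [|w]; last exact: cos_max.
    apply: (measurableT_comp (f := cos)) => //.
      by apply: continuous_measurable_fun; exact: continuous_cos.
    by apply: measurable_funM => //; exact: measurable_funB.
  by rewrite expectation_cos_shift mulrDr !mulrA.
- apply: measurable_funM.
    apply: (measurableT_comp (f := expR)) => //.
    by apply: measurableT_comp => //; exact: measurable_funM.
  apply: (measurableT_comp (f := cos)) => //.
    by apply: continuous_measurable_fun; exact: continuous_cos.
  apply: measurable_funM => //; apply: measurable_funB => //.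
  exact: (measurableT_comp (f := X)).
- exact: integrable_expRN.
- by move=> w x _; rewrite normrM ger0_norm ?expR_ge0// ler_piMr ?expR_ge0// cos_max.
Qed.
End fourier_inversion.

(** * Densities tested on half-open intervals *)

Section ocitv_density.
Context {R : realType}.
Notation mu := (@lebesgue_measure R).
Variables (m : probability R R) (f : R -> R).
Hypotheses (mf : measurable_fun setT f) (f0 : forall x, 0 <= f x).

(** Half-open intervals are stable under intersection and generate the Borel sets. As [f] is
    nonnegative, its integral is a measure, and two measures that agree on such a family, with
    finite mass on an exhaustion of the line, are equal. *)
Lemma ocitv_density_unique :
  (forall c e : R, c < e -> m `]c, e]%classic = (\int[mu]_(x in `]c, e]) (f x)%:E)%E) ->
  forall A : set R, measurable A ->
    m A = (\int[mu]_(x in A) (f x)%:E)%E.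
Proof.
move=> mE.
pose n0 (A : set R) : \bar R := (\int[mu]_(x in A) (f x)%:E)%E.
have n00 : n0 set0 = 0%E by rewrite /n0 integral_set0.
have n0_ge0 A : (0 <= n0 A)%E by apply: integral_ge0 => x _; rewrite lee_fin.
have n0_add : semi_sigma_additive n0.
  move=> /= F mF tF mUF; rewrite /n0; apply: cvg_toP.
    apply: ereal_nondecreasing_is_cvgn => m1 n1 mn.
    apply: lee_sum_nneg_natr => // k _ _; exact: n0_ge0.
  rewrite ge0_integral_bigcup//=.
  - by apply/measurable_funTS/measurableT_comp.
  - by move=> x _; rewrite lee_fin.
pose n : {measure set R -> \bar R} :=
  HB.pack n0 (isMeasure.Build _ _ _ n0 n00 n0_ge0 n0_add).
move=> A mA; rewrite -[RHS]/(n A).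
refine (@measure_unique _ R R (@ocitv R)
  (fun k => `](- k%:R), k%:R]%classic) _ _ _ _ m n _ _ A mA) => //.
- exact: ocitvI.
- by move=> k; exact: is_ocitv.
- apply/seteqP; split => // x _.
  exists (Num.bound `|x|) => //=; rewrite in_itv/=.
  have := lt_le_trans (archi_boundP (normr_ge0 x)) (lexx _); rewrite ltr_norml.
  by case/andP => -> /ltW.
- move=> B /ocitvP[->|[[c e]/= ce ->]]; first by rewrite !measure0.
  by rewrite mE.
- by move=> k; rewrite ltey_eq fin_num_measure.
Qed.
End ocitv_density.

(** * Arctangents as integrals of the kernel *)

Section shifted_atan.
Context {R : realType}.
Notation mu := (@lebesgue_measure R).

Lemma Rintegral_poisson_kernel (s x c e : R) : 0 < s -> c < e ->
  \int[mu]_(a in `[c, e]) (s / (s ^+ 2 + (x - a) ^+ 2)) =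
  atan ((e - x) / s) - atan ((c - x) / s).
Proof.
move=> s0 ce.
have d1 (a : R) : is_derive a 1 (fun a => (a - x) / s) s^-1.
  apply: (is_derive_val (is_derive_mul (is_derive_add (is_derive_id a 1)
    (is_derive_cst (- x) a 1)) (is_derive_cst s^-1 a 1))).
  by rewrite addr0 mul1r mulr0 addr0.
have dF (a : R) : is_derive a 1 (fun a => atan ((a - x) / s))
    (s / (s ^+ 2 + (x - a) ^+ 2)).
  apply: (is_derive_val (is_derive_chain (d1 a) (is_derive1_atan _))).
  have sx0 : 0 < s ^+ 2 + (x - a) ^+ 2.
    by rewrite ltr_wpDr ?sqr_ge0// exprn_gt0.
  have -> : 1 + ((a - x) / s) ^+ 2 = (s ^+ 2 + (x - a) ^+ 2) / s ^+ 2.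
    by field; exact: lt0r_neq0.
  by rewrite invf_div; field; rewrite !lt0r_neq0.
have cF (a : R) : {for a, continuous (fun a => atan ((a - x) / s))}.
  exact: (is_derive_continuous (dF a)).
rewrite /Rintegral (@continuous_FTC2 _ _ (fun a => atan ((a - x) / s)))//.
- apply: continuous_in_subspaceT => a _.
  have sx0 : 0 < s ^+ 2 + (x - a) ^+ 2.
    by rewrite ltr_wpDr ?sqr_ge0// exprn_gt0.
  apply: cvgM; first exact: cvg_cst.
  apply: cvgV; first exact: lt0r_neq0.
  apply: cvgD; first exact: cvg_cst.
  by apply: cvgM; (apply: cvgB; [exact: cvg_cst|exact: cvg_id]).
- split.
  + move=> a _; exact: (@ex_derive _ _ _ _ _ _ _ (dF a)).
  + by apply: cvg_at_right_filter; exact: cF.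
  + by apply: cvg_at_left_filter; exact: cF.
- by move=> a _; rewrite derive1E; exact: (@derive_val _ _ _ _ _ _ _ (dF a)).
Qed.

Lemma cvg_atan_dilation_gt0 (y : R) : 0 < y ->
  atan (y / n.+1%:R^-1) @[n --> \oo] --> pi / 2.
Proof.
move=> y0.
have yoo : y / n.+1%:R^-1 @[n --> \oo] --> +oo.
  apply: (proj2 (@cvgryPge _ _ _ _ _)) => A; near=> n.
  rewrite invrK mulrC -ler_pdivrMr//.
  apply: (@le_trans _ _ n%:R); last by rewrite ler_nat.
  by near: n; exact: nbhs_infty_ger.
exact: (cvg_comp _ _ yoo (@cvgy_atan R)).
Unshelve. all: by end_near. Qed.

Lemma cvg_atan_dilation_lt0 (y : R) : y < 0 ->
  atan (y / n.+1%:R^-1) @[n --> \oo] --> - (pi / 2).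
Proof.
move=> y0.
have -> : (fun n => atan (y / n.+1%:R^-1)) = (fun n => - atan (- y / n.+1%:R^-1)).
  by apply/funext => n; rewrite mulNr atanN opprK.
by apply: cvgN; apply: cvg_atan_dilation_gt0; rewrite oppr_gt0.
Qed.

End shifted_atan.

(** * The damped inversion integral *)

Section half_fourier_smoothing.
Context {R : realType}.
Notation mu := (@lebesgue_measure R).
Notation H := (`]0%R, +oo[%classic : set R).

Lemma measurable_expRN (s : R) : measurable_fun H (fun x => expR (- (s * x))).
Proof.
apply: (measurableT_comp (f := expR)) => //.
by apply: measurableT_comp => //; exact: measurable_funM.
Qed.

Lemma expRN_le1 (s x : R) : 0 < s -> H x -> `|expR (- (s * x))| <= 1.
Proof.
move=> s0 /half_lineE x0; rewrite ger0_norm ?expR_ge0// -expR0 ler_expR.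
by rewrite oppr_le0 mulr_ge0 ?ltW.
Qed.

Lemma integrable_expRN_mul (s : R) (u : R -> R) : 0 < s ->
  mu.-integrable H (EFin \o u) ->
  mu.-integrable H (EFin \o (fun x => expR (- (s * x)) * u x)).
Proof.
move=> s0 iu; apply: (le_integrable _ _ _ iu) => //.
  apply/measurable_EFinP; apply: measurable_funM; first exact: measurable_expRN.
  by apply/measurable_EFinP; exact: measurable_int iu.
move=> x Hx /=; rewrite lee_fin normrM ler_piMl//; exact: expRN_le1.
Qed.

Variables u v : R -> R.
Hypotheses (iu : mu.-integrable H (EFin \o u)) (iv : mu.-integrable H (EFin \o v)).

Definition smoothed_half_fourier (s : R) : R -> R :=
  half_fourier (fun x => expR (- (s * x)) * u x) (fun x => expR (- (s * x)) * v x).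

(** The bound is uniform in [s] and [a]. It serves as a constant majorant on [[c, e]], and it rules
    out atoms. *)
Lemma norm_smoothed_half_fourier_le (s a : R) : 0 < s ->
  `|smoothed_half_fourier s a| <= \int[mu]_(x in H) (`|u x| + `|v x|).
Proof.
move=> s0; have ius := integrable_expRN_mul s0 iu.
have ivs := integrable_expRN_mul s0 iv.
apply: (le_trans (norm_half_fourier_le ius ivs a)).
apply: le_Rintegral => //.
- exact: integrable_half_fourier_bound ius ivs.
- exact: integrable_half_fourier_bound iu iv.
- by move=> x Hx; rewrite !normrM lerD// ler_piMl//; exact: expRN_le1.
Qed.

Lemma cvg_smoothed_half_fourier (a : R) :
  smoothed_half_fourier n.+1%:R^-1 a @[n --> \oo] --> half_fourier u v a.
Proof.
apply: (@cvg_Rintegral_dominated _ _ _ mu H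
  (fun n x => expR (- (n.+1%:R^-1 * x)) * u x * cos (x * a) +
              expR (- (n.+1%:R^-1 * x)) * v x * sin (x * a)) _
  (fun x => `|u x| + `|v x|)) => //.
- move=> n; have n0 : 0 < n.+1%:R^-1 :> R by rewrite invr_gt0.
  apply/measurable_EFinP; apply: measurable_int.
  by apply: integrable_half_fourier; exact: integrable_expRN_mul.
- apply/measurable_EFinP; apply: measurable_int.
  exact: (integrable_half_fourier iu iv a).
- apply: aeW => x Hx.
  have cE : expR (- (n.+1%:R^-1 * x)) @[n --> \oo] --> (1 : R).
    have c0 : - (n.+1%:R^-1 * x) @[n --> \oo] --> (0 : R).
      have := cvgN (cvgM (@cvg_harmonic R) (cvg_cst x)).
      by rewrite mul0r oppr0; exact.
    by have := cvg_comp _ _ c0 (@continuous_expR R 0); rewrite expR0; exact.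
  have := cvgM cE (cvg_cst (u x * cos (x * a) + v x * sin (x * a))).
  rewrite mul1r.
  suff -> : (fun n : nat => expR (- (n.+1%:R^-1 * x)) * u x * cos (x * a) +
      expR (- (n.+1%:R^-1 * x)) * v x * sin (x * a)) = (fun n =>
      expR (- (n.+1%:R^-1 * x)) * (u x * cos (x * a) + v x * sin (x * a))) by exact.
  by apply/funext => n; rewrite mulrDr !mulrA.
- exact: integrable_half_fourier_bound iu iv.
- move=> n x Hx; apply: (le_trans (norm_half_fourier_integrand
    (fun x => expR (- (n.+1%:R^-1 * x)) * u x)
    (fun x => expR (- (n.+1%:R^-1 * x)) * v x) x a)).
  by rewrite !normrM lerD// ler_piMl//; exact: expRN_le1.
Qed.

Lemma cvg_Rintegral_smoothed_half_fourier (c e : R) :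
  \int[mu]_(a in `[c, e]) smoothed_half_fourier n.+1%:R^-1 a @[n --> \oo] -->
  \int[mu]_(a in `[c, e]) half_fourier u v a.
Proof.
apply: (@cvg_Rintegral_dominated _ _ _ mu `[c, e]
  (fun n => smoothed_half_fourier n.+1%:R^-1) _
  (cst (\int[mu]_(x in H) (`|u x| + `|v x|)))) => //.
- move=> n; have n0 : 0 < n.+1%:R^-1 :> R by rewrite invr_gt0.
  apply: measurable_funTS; apply: continuous_measurable_fun.
  by apply: continuous_half_fourier; exact: integrable_expRN_mul.
- apply: measurable_funTS; apply: continuous_measurable_fun.
  exact: (continuous_half_fourier iu iv).
- by apply: aeW => a _; exact: cvg_smoothed_half_fourier.
- apply: measurable_bounded_integrable => //=.
    by rewrite lebesgue_measure_itv/=; case: ifP => //; rewrite ltry.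
  exact: bounded_cst.
- by move=> n a _; exact: norm_smoothed_half_fourier_le.
Qed.

End half_fourier_smoothing.

(** * Removing the damping *)

Section fourier_inversion.
Context d (T : measurableType d) (R : realType) (P : probability T R).
Variable X : {RV P >-> R}.
Notation mu := (@lebesgue_measure R).
Notation H := (`]0%R, +oo[%classic : set R).
Let u (g : R) : R := \int[P]_w cos (g * X w).
Let v (g : R) : R := \int[P]_w sin (g * X w).
Hypotheses (iu : mu.-integrable H (EFin \o u)) (iv : mu.-integrable H (EFin \o v)).

Lemma measurable_poisson_kernel (s : R) : 0 < s ->
  measurable_fun setT (fun y : R => s / (s ^+ 2 + y ^+ 2)).
Proof.
move=> s0; apply: continuous_measurable_fun => y.
have sx0 : 0 < s ^+ 2 + y ^+ 2 by rewrite ltr_wpDr ?sqr_ge0// exprn_gt0.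
apply: cvgM; first exact: cvg_cst.
apply: cvgV; first exact: lt0r_neq0.
apply: cvgD; first exact: cvg_cst.
by apply: cvgM; exact: cvg_id.
Qed.

Lemma poisson_kernel_bounds (s y : R) : 0 < s ->
  0 <= s / (s ^+ 2 + y ^+ 2) <= s^-1.
Proof.
move=> s0; have sx0 : 0 < s ^+ 2 + y ^+ 2.
  by rewrite ltr_wpDr ?sqr_ge0// exprn_gt0.
apply/andP; split; first by rewrite divr_ge0 ?ltW.
rewrite ler_pdivrMr// -[X in X <= _](mulKf (lt0r_neq0 s0)).
by rewrite ler_pM2l ?invr_gt0// -expr2 lerDl sqr_ge0.
Qed.

(** Invisible on the oscillating integral, the sign is inherited in the limit from expectations of
    the positive kernel. *)
Lemma half_fourier_ge0 (a : R) : 0 <= half_fourier u v a.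
Proof.
apply: (cvgr_to_ge (@cvg_smoothed_half_fourier _ _ _ iu iv a)).
apply: nearW => n; have n0 : 0 < n.+1%:R^-1 :> R by rewrite invr_gt0.
rewrite /smoothed_half_fourier -(expectation_poisson_kernel X)//; apply: Rintegral_ge0 => w _.
by have /andP[] := poisson_kernel_bounds (X w - a) n0.
Qed.

(** The kernel equals [1 / s] at its centre, so an atom of mass [p] at [a] contributes [p / s] to
    the smoothed integral at [a]. That integral stays below a constant [B] for every [s]; taking
    [s = 1 / (n+1)] forces [p = 0]. *)
Lemma RV_no_atom (a : R) : P (X @^-1` [set a]) = 0%E.
Proof.
have mA : measurable (X @^-1` [set a]) by exact: measurable_funPTI.
have [p pE] : exists p : R, P (X @^-1` [set a]) = p%:E.
  by exists (fine (P (X @^-1` [set a]))); rewrite fineK// fin_num_measure.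
have p0 : 0 <= p by rewrite -lee_fin -pE.
set B := \int[mu]_(x in H) (`|u x| + `|v x|).
suff pB n : p * n.+1%:R <= B.
  rewrite pE; congr EFin; apply/eqP; rewrite eq_le p0 andbT leNgt.
  apply/negP => p_gt0; have := pB (Num.bound `|B / p|); apply/negP.
  rewrite -ltNge mulrC -ltr_pdivrMr//.
  rewrite (le_lt_trans (ler_norm _))// (lt_le_trans (archi_boundP (normr_ge0 _)))//.
  by rewrite ler_nat.
have n0 : 0 < n.+1%:R^-1 :> R by rewrite invr_gt0.
apply: le_trans (norm_smoothed_half_fourier_le iu iv a n0).
rewrite /smoothed_half_fourier -(expectation_poisson_kernel X)//.
apply: le_trans (ler_norm _).
have -> : p * n.+1%:R = \int[P]_w (n.+1%:R * \1_(X @^-1` [set a]) w).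
  rewrite RintegralZl//; last first.
    by apply: (@bounded_RV_integrable _ _ _ P _ 1) => [|w]; rewrite ?ger0_norm.
  rewrite /Rintegral integral_indic// setIT [X in fine X](_ : _ = p%:E)//.
  by rewrite mulrC.
apply: le_Rintegral => //.
- apply: (@bounded_RV_integrable _ _ _ P _ n.+1%:R) => [|w].
    exact: measurable_funM.
  by rewrite ger0_norm ?mulr_ge0// ler_piMr// indicE; case: (_ \in _).
- apply: (@bounded_RV_integrable _ _ _ P _ n.+1%:R) => [|w].
    apply: (measurableT_comp (measurable_poisson_kernel n0)).
    exact: measurable_funB.
  have /andP[k0 k1] := poisson_kernel_bounds (X w - a) n0.
  by rewrite ger0_norm// (le_trans k1)// invrK.
- move=> w _; rewrite indicE.
  have [/set_mem /= ->|_] := boolP (w \in X @^-1` [set a]).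
    by rewrite subrr expr0n/= addr0 mulr1 expr2 invfM mulrA divff ?mul1r ?invrK// lt0r_neq0.
  by rewrite mulr0; have /andP[] := poisson_kernel_bounds (X w - a) n0.
Qed.

Lemma probability_ocitv (c e : R) : c < e ->
  pi * fine (P (X @^-1` `]c, e])) = \int[mu]_(a in `[c, e]) half_fourier u v a.
Proof.
move=> ce.
have mA : measurable (X @^-1` `]c, e]) by exact: measurable_funPTI.
have cvgI := @cvg_Rintegral_smoothed_half_fourier _ _ _ iu iv c e.
have smE n : \int[mu]_(a in `[c, e]) smoothed_half_fourier u v n.+1%:R^-1 a =
    \int[P]_w (atan ((e - X w) / n.+1%:R^-1) - atan ((c - X w) / n.+1%:R^-1)).
  have n0 : 0 < n.+1%:R^-1 :> R by rewrite invr_gt0.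
  under eq_Rintegral do rewrite /smoothed_half_fourier -(expectation_poisson_kernel X)//.
  (* For this fixed [s] the kernel is at most [1 / s = n+1], a constant integrable over the bounded
     interval. *)
  rewrite -(@Rintegral_Fubini_dominated _ _ _ _ _ P mu `[c, e]
    (fun w a => n.+1%:R^-1 / (n.+1%:R^-1 ^+ 2 + (X w - a) ^+ 2)) (cst n.+1%:R)) //.
  - by apply: eq_Rintegral => w _; exact: Rintegral_poisson_kernel.
  - apply: (measurableT_comp (f := fun y : R => n.+1%:R^-1 / (n.+1%:R^-1 ^+ 2 + y ^+ 2))).
      exact: measurable_poisson_kernel.
    apply: measurable_funB => //; exact: (measurableT_comp (f := X)).
  - apply: measurable_bounded_integrable => //=.
      by rewrite lebesgue_measure_itv/=; case: ifP => //; rewrite ltry.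
    exact: bounded_cst.
  - move=> w a _; have /andP[k0 k1] := poisson_kernel_bounds (X w - a) n0.
    by rewrite ger0_norm// (le_trans k1)// invrK.
(* One limit of the arctangent expectations is known; it remains to find the other by dominated
   convergence on the probability space. *)
rewrite (eq_cvg _ _ smE) in cvgI; apply: cvg_unique cvgI => //.
have -> : pi * fine (P (X @^-1` `]c, e])) = \int[P]_w (pi * \1_(X @^-1` `]c, e]) w).
  rewrite RintegralZl//; last first.
    by apply: (@bounded_RV_integrable _ _ _ P _ 1) => [|w]; rewrite ?ger0_norm.
  by rewrite /Rintegral integral_indic// setIT.
apply: (@cvg_Rintegral_dominated _ _ _ P setT
  (fun n w => atan ((e - X w) / n.+1%:R^-1) - atan ((c - X w) / n.+1%:R^-1)) _
  (cst pi)) => //.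
- have matan : measurable_fun setT (@atan R).
    by apply: continuous_measurable_fun => y; exact: continuous_atan.
  move=> n; apply: measurable_funB; apply: (measurableT_comp matan);
    by apply: measurable_funM => //; exact: measurable_funB.
- exact: measurable_funM.
(* At either endpoint the arctangent difference tends to [pi / 2], which is neither of the values
   [0] and [pi] of the target. These are the only exceptional points, and they are null because
   there are no atoms. *)
- exists (X @^-1` [set c] `|` X @^-1` [set e]); split.
  + by apply: measurableU; exact: measurable_funPTI.
  + by apply: null_set_setU; try exact: RV_no_atom; exact: measurable_funPTI.
  + move=> w; apply: contra_notP => /= /not_orP[nXc nXe] _.
    have [eX|Xe] := ltP (X w) e; last first.
      have Xe' : e - X w < 0 by rewrite subr_lt0 lt_neqAle Xe andbT; apply/eqP => /esym.
      have Xc' : c - X w < 0 by rewrite subr_lt0 (lt_le_trans ce).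
      have := cvgB (cvg_atan_dilation_lt0 Xe') (cvg_atan_dilation_lt0 Xc').
      rewrite subrr indicE memNset ?mulr0 /=; first exact.
      by rewrite in_itv/= leNgt -[e < X w]subr_lt0 Xe' andbF.
    have Xe' : 0 < e - X w by rewrite subr_gt0.
    have [cX|Xlc] := ltP c (X w).
      have Xc' : c - X w < 0 by rewrite subr_lt0.
      have := cvgB (cvg_atan_dilation_gt0 Xe') (cvg_atan_dilation_lt0 Xc').
      rewrite opprK -splitr indicE mem_set ?mulr1 /=; first exact.
      by rewrite in_itv/= cX ltW.
    have Xc' : 0 < c - X w by rewrite subr_gt0 lt_neqAle Xlc andbT; apply/eqP.
    have := cvgB (cvg_atan_dilation_gt0 Xe') (cvg_atan_dilation_gt0 Xc').
    rewrite subrr indicE memNset ?mulr0 /=; first exact.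
    by rewrite in_itv/= ltNge Xlc.
- exact: finite_measure_integrable_cst.
- move=> n w _.
  have := atan_ltpi2 ((e - X w) / n.+1%:R^-1).
  have := atan_gtNpi2 ((e - X w) / n.+1%:R^-1).
  have := atan_ltpi2 ((c - X w) / n.+1%:R^-1).
  have := atan_gtNpi2 ((c - X w) / n.+1%:R^-1).
  by rewrite ler_norml /=; lra.
Qed.

Theorem fourier_inversion_pdf :
  continuous_pdf X (fun a => pi^-1 * half_fourier u v a).
Proof.
have f0 a : 0 <= pi^-1 * half_fourier u v a.
  by rewrite mulr_ge0 ?invr_ge0 ?pi_ge0// half_fourier_ge0.
have cf : continuous (fun a => pi^-1 * half_fourier u v a).
  move=> a; apply: cvgM; first exact: cvg_cst.
  exact: (continuous_half_fourier iu iv).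
split => // A mA.
apply: (@ocitv_density_unique _ (distribution P X) _ _ f0) => //.
  exact: continuous_measurable_fun.
move=> c e ce.
have iI : mu.-integrable `[c, e] (EFin \o half_fourier u v).
  apply: continuous_compact_integrable; first exact: segment_compact.
  by apply: continuous_subspaceT; exact: (continuous_half_fourier iu iv).
rewrite integral_itv_obnd_cbnd; last first.
  apply/measurable_EFinP; apply: measurable_funTS.
  exact: continuous_measurable_fun.
transitivity (\int[mu]_(a in `[c, e]) (pi^-1 * half_fourier u v a))%:E.
  rewrite RintegralZl// -probability_ocitv// mulKf ?gt_eqF ?pi_gt0//.
  by rewrite fineK// fin_num_measure//; exact: measurable_funPTI.
rewrite /Rintegral fineK//.
by apply: integrable_fin_num => //; exact: (integrableZl _ pi^-1 iI).
Qed.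

End fourier_inversion.

(** * Moments of rotated stretched exponentials *)

Section stretched_exponential.
Context {R : realType}.
Notation mu := (@lebesgue_measure R).
Notation H := (`]0%R, +oo[%classic : set R).

Lemma powR_expR_ln (x r : R) : 0 < x -> x `^ r = expR (r * ln x).
Proof. by move=> x0; rewrite mulrC expRM lnK. Qed.

Lemma powR_le_expR (x r : R) : 0 < x -> 0 <= r -> x `^ r <= expR (r * x).
Proof.
by move=> x0 r0; rewrite powR_expR_ln// ler_expR ler_wpM2l// ltW// ln_sublinear.
Qed.

Lemma linear_sub_powR_le (nu a b : R) : 1 < nu -> 0 < a ->
  exists C : R, forall x : R, 0 < x -> b * x - a * x `^ nu <= C - x.
Proof.
move=> nu1 a0; set k := `|b| + 1.
have k0 : 0 < k by rewrite ltr_wpDl.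
have nu10 : 0 < nu - 1 by rewrite subr_gt0.
(* The crossing point [a M^nu = k M]: below it [k x <= k M], above it the power term absorbs [k x].
   The extra 1 in [k] pays for the [- x] of the conclusion. *)
pose M := (k / a) `^ (nu - 1)^-1.
have ME : M `^ (nu - 1) = k / a.
  by rewrite -powRrM mulVf ?gt_eqF// powRr1// divr_ge0 ?ltW.
exists (k * M) => x x0; rewrite lerBrDr.
have bx : b * x + x <= k * x.
  by rewrite mulrDl mul1r lerD2r ler_pM2r// ler_norm.
have xE : x `^ nu = x * x `^ (nu - 1) by rewrite mulr_powRB1 ?ltW// (lt_trans _ nu1).
have [xM|Mx] := leP x M.
  have : k * x <= k * M by rewrite ler_pM2l.
  have : 0 <= a * x `^ nu by rewrite mulr_ge0 ?powR_ge0 ?ltW.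
  lra.
have : k * x <= a * x `^ nu.
  rewrite xE mulrCA [k * x]mulrC ler_pM2l//.
  rewrite mulrC -ler_pdivrMr// -ME; apply: ge0_ler_powR; rewrite ?ltW//.
  - by rewrite nnegrE powR_ge0.
  - by rewrite nnegrE ltW.
have : 0 <= k * M by rewrite mulr_ge0 ?powR_ge0 ?ltW.
lra.
Qed.

(** Since [x^r <= e^(r x)], the power only enlarges the linear term [b x], and any linear term is
    beaten by [a x^nu]. *)
Lemma stretched_exponential_le (nu a b r : R) : 1 < nu -> 0 < a -> 0 <= r ->
  exists2 C : R, 0 <= C & forall x : R, 0 < x ->
    x `^ r * expR (b * x - a * x `^ nu) <= C * expR (- x).
Proof.
move=> nu1 a0 r0; have [C HC] := linear_sub_powR_le (r + b) nu1 a0.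
exists (expR C) => [|x x0]; first exact: expR_ge0.
apply: (@le_trans _ _ (expR (r * x) * expR (b * x - a * x `^ nu))).
  by rewrite ler_wpM2r ?expR_ge0// powR_le_expR.
by rewrite -!expRD ler_expR addrA -mulrDl HC.
Qed.

Lemma in_continuous_powR (r : R) : {in `]0, +oo[, continuous (fun x : R => x `^ r)}.
Proof.
move=> x; rewrite in_itv/= andbT => x0.
exact: (is_derive_continuous (is_derive1_powR r x0)).
Qed.

Lemma integrable_stretched_exponential (nu a b r : R) : 1 < nu -> 0 < a -> 0 <= r ->
  mu.-integrable H (EFin \o (fun x => x `^ r * expR (b * x - a * x `^ nu))).
Proof.
move=> nu1 a0 r0; have [C C0 HC] := stretched_exponential_le b nu1 a0 r0.
have mH : measurable (H : set (measurableTypeR R)) by [].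
have iC := integrableZl mH C (@integrable_expRN R 1 ltr01).
apply: (le_integrable _ _ _ iC) => //.
  apply/measurable_EFinP; apply: measurable_half_line => x x0.
  have {}x0 : 0 < x by move: x0; rewrite in_itv/= andbT.
  exact: (is_derive_continuous (is_derive_mul (is_derive1_powR r x0)
    (is_derive_expR_comp (is_derive_add (is_derive_scale b (is_derive_id x 1))
      (is_derive_opp (is_derive_scale a (is_derive1_powR nu x0))))))).
move=> x /half_lineE x0 /=.
rewrite lee_fin ger0_norm ?mulr_ge0 ?powR_ge0 ?expR_ge0//.
by rewrite (le_trans (HC _ x0))// mul1r ler_norm.
Qed.

Lemma integrable_powR_decay (nu a r : R) : 1 < nu -> 0 < a -> 0 <= r ->
  mu.-integrable H (EFin \o (fun x => x `^ r * expR (- (a * x `^ nu)))).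
Proof.
move=> nu1 a0 r0; have := integrable_stretched_exponential 0 nu1 a0 r0.
suff -> : (fun x => x `^ r * expR (- (a * x `^ nu))) =
    (fun x => x `^ r * expR (0 * x - a * x `^ nu)) by [].
by apply/funext => x; rewrite mul0r add0r.
Qed.

Lemma cvgy_stretched_exponential (nu a r : R) : 1 < nu -> 0 < a -> 0 <= r ->
  x `^ r * expR (- (a * x `^ nu)) @[x --> +oo] --> (0 : R).
Proof.
move=> nu1 a0 r0; have [C C0 HC] := stretched_exponential_le 0 nu1 a0 r0.
have cC : C * expR (- x) @[x --> +oo] --> (0 : R).
  by have := cvgM (cvg_cst C) (@cvgr_expR R); rewrite mulr0; exact.
apply: (squeeze_cvgr _ (cvg_cst 0) cC).
near=> x; have x0 : 0 < x by [].
rewrite mulr_ge0 ?powR_ge0 ?expR_ge0//=.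
by have := HC _ x0; rewrite mul0r add0r.
Unshelve. all: by end_near. Qed.

End stretched_exponential.

(** * Rotating the ray of integration *)

Section rotated_moments.
Context {R : realType}.
Notation mu := (@lebesgue_measure R).
Notation H := (`]0%R, +oo[%classic : set R).
Variables (nu t q delta : R).
Hypotheses (nu1 : 1 < nu) (t0 : 0 < t) (q1 : 1 <= q).

Let nu0 : 0 < nu. Proof. exact: lt_trans nu1. Qed.
Let q0 : 0 < q. Proof. exact: lt_le_trans q1. Qed.
Let qB1 : 0 <= q - 1. Proof. by rewrite subr_ge0. Qed.

(** On the ray [z = x e^(i phi / nu)] one has [z^nu = x^nu e^(i phi)], and [kernel phi] is the real
    part of [e^(- i delta) z^(q-1) e^(- t z^nu) dz/dx]. The term [q / nu * phi] is the argument of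
    [z^(q-1) dz/dx]; the constant [delta] is free, to be matched later with the phase of a Taylor
    coefficient. *)
Let phase (phi x : R) := t * sin phi * x `^ nu - q / nu * phi + delta.
Let decay (phi x : R) := expR (- (t * cos phi * x `^ nu)).
Let kernel (phi x : R) := x `^ (q - 1) * (decay phi x * cos (phase phi x)).
Let dkernel (phi x : R) := x `^ (q - 1) * (decay phi x *
  (t * sin phi * x `^ nu * cos (phase phi x) -
   (t * cos phi * x `^ nu - q / nu) * sin (phase phi x))).

Let is_derive_phase_phi (phi x : R) :
  is_derive phi 1 (phase ^~ x) (t * cos phi * x `^ nu - q / nu).
Proof.
apply: (is_derive_val (is_derive_add (is_derive_add
  (is_derive_mul (is_derive_scale t (is_derive_sin phi)) (is_derive_cst (x `^ nu) phi 1))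
  (is_derive_opp (is_derive_scale (q / nu) (is_derive_id phi 1))))
  (is_derive_cst delta phi 1))).
by rewrite /=; ring.
Qed.

Let is_derive_decay_phi (phi x : R) :
  is_derive phi 1 (decay ^~ x) (t * sin phi * x `^ nu * decay phi x).
Proof.
apply: (is_derive_val (is_derive_expR_comp (is_derive_opp
  (is_derive_mul (is_derive_scale t (is_derive_cos phi)) (is_derive_cst (x `^ nu) phi 1))))).
by rewrite /decay /=; ring.
Qed.

Let is_derive_kernel_phi (phi x : R) : is_derive phi 1 (kernel ^~ x) (dkernel phi x).
Proof.
apply: (is_derive_val (is_derive_scale (x `^ (q - 1)) (is_derive_mul
  (is_derive_decay_phi phi x) (is_derive_cos_comp (is_derive_phase_phi phi x))))).
by rewrite /dkernel /=; ring.
Qed.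

Let is_derive_decay_x (phi x : R) : 0 < x ->
  is_derive x 1 (decay phi) (- (t * cos phi * (nu * x `^ (nu - 1))) * decay phi x).
Proof.
move=> x0; exact: (is_derive_expR_comp (is_derive_opp
  (is_derive_scale (t * cos phi) (is_derive1_powR nu x0)))).
Qed.

Let is_derive_phase_x (phi x : R) : 0 < x ->
  is_derive x 1 (phase phi) (t * sin phi * (nu * x `^ (nu - 1))).
Proof.
move=> x0; apply: (is_derive_val (is_derive_add (is_derive_add
  (is_derive_scale (t * sin phi) (is_derive1_powR nu x0))
  (is_derive_cst (- (q / nu * phi)) x 1)) (is_derive_cst delta x 1))).
by rewrite !addr0.
Qed.

(** The real part of [(i / nu) e^(- i delta) z^q e^(- t z^nu)] on the same ray. *)
Let primitive (phi x : R) := nu^-1 * (x `^ q * (decay phi x * sin (phase phi x))).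

(* Cauchy-Riemann: the rotation derivative of the kernel is an x-derivative. *)
Let is_derive_primitive (phi x : R) : 0 < x ->
  is_derive x 1 (primitive phi) (dkernel phi x).
Proof.
move=> x0; apply: (is_derive_val (is_derive_scale nu^-1 (is_derive_mul
  (is_derive1_powR q x0) (is_derive_mul (is_derive_decay_x phi x0)
    (is_derive_sin_comp (is_derive_phase_x phi x0)))))).
rewrite /dkernel /=; move: (decay phi x) (sin (phase phi x)) (cos (phase phi x)).
move=> e S C; rewrite -(mulr_powRB1 (ltW x0) q0) -(mulr_powRB1 (ltW x0) nu0).
by field; exact: lt0r_neq0.
Qed.

Let decay_le1 (phi x : R) : 0 < cos phi -> decay phi x <= 1.
Proof.
move=> c0; rewrite -expR0 ler_expR oppr_le0.
by rewrite !mulr_ge0 ?powR_ge0 ?ltW.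
Qed.

Let cvg0_primitive (phi : R) : 0 < cos phi -> primitive phi x @[x --> 0^'+] --> 0.
Proof.
move=> c0.
have h := @cvg0_bounded_mul _ _ _ _ _ (fun x => decay phi x * sin (phase phi x)) 1
  (powR_cvg0 q0).
suff /h/(cvgM (cvg_cst nu^-1)) : forall x, `|decay phi x * sin (phase phi x)| <= 1.
  by rewrite mulr0; exact.
move=> x; rewrite normrM ger0_norm ?expR_ge0//.
by rewrite mulr_ile1 ?expR_ge0 ?decay_le1// sin_max.
Qed.

Let cvgy_primitive (phi : R) : 0 < cos phi -> primitive phi x @[x --> +oo] --> 0.
Proof.
move=> c0; have tc0 : 0 < t * cos phi by rewrite mulr_gt0.
have h := @cvg0_bounded_mul _ _ _ _ _ (fun x => sin (phase phi x)) 1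
  (cvgy_stretched_exponential nu1 tc0 (ltW q0)).
have /h/(cvgM (cvg_cst nu^-1)) : forall x, `|sin (phase phi x)| <= 1.
  by move=> x; exact: sin_max.
rewrite mulr0 /primitive; under [in X in _ -> X]eq_fun do rewrite [X in nu^-1 * X]mulrA.
exact.
Qed.

(** Bounds the rotation derivative for all angles with [cos phi >= c] at once, as differentiation
    under the integral requires. The 2 counts the sine and the cosine term, each at most
    [t x^nu]. *)
Let majorant (c x : R) := 2 * t * (x `^ (q - 1 + nu) * expR (- (t * c * x `^ nu))) +
  q / nu * (x `^ (q - 1) * expR (- (t * c * x `^ nu))).

Let majorant_ge0 (c x : R) : 0 <= majorant c x.
Proof.
by rewrite addr_ge0// !mulr_ge0 ?expR_ge0 ?powR_ge0 ?invr_ge0 ?(ltW t0) ?(ltW q0)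
  ?(ltW nu0).
Qed.

Let integrable_majorant (c : R) : 0 < c -> mu.-integrable H (EFin \o majorant c).
Proof.
move=> c0; have tc0 : 0 < t * c by rewrite mulr_gt0.
have qnu : 0 <= q - 1 + nu by rewrite addr_ge0// ltW.
have mH : measurable (H : set (measurableTypeR R)) by [].
have i1 := integrableZl mH (2 * t) (integrable_powR_decay nu1 tc0 qnu).
have i2 := integrableZl mH (q / nu) (integrable_powR_decay nu1 tc0 qB1).
exact: (integrableD mH i1 i2).
Qed.

Let norm_dkernel_le (c phi x : R) : 0 < c -> c <= cos phi -> 0 < x ->
  `|dkernel phi x| <= majorant c x.
Proof.
move=> c0 cphi x0; have E0 : 0 <= x `^ nu by exact: powR_ge0.
have dec : decay phi x <= expR (- (t * c * x `^ nu)).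
  by rewrite ler_expR lerN2 ler_wpM2r// ler_pM2l.
have qn0 : 0 <= q / nu by rewrite divr_ge0 ?ltW.
have osc : `|t * sin phi * x `^ nu * cos (phase phi x) -
   (t * cos phi * x `^ nu - q / nu) * sin (phase phi x)| <= 2 * t * x `^ nu + q / nu.
  have n1 : `|t * sin phi * x `^ nu * cos (phase phi x)| <= t * x `^ nu.
    rewrite !normrM (gtr0_norm t0) (ger0_norm E0) -[leRHS]mulr1.
    rewrite ler_pM ?mulr_ge0 ?cos_max ?(ltW t0)// ler_wpM2r//.
    by rewrite ler_piMr ?sin_max// ltW.
  have n2 : `|(t * cos phi * x `^ nu - q / nu) * sin (phase phi x)| <= t * x `^ nu + q / nu.
    rewrite normrM -[leRHS]mulr1 ler_pM ?sin_max//.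
    rewrite (le_trans (ler_normB _ _))// (ger0_norm qn0) lerD2r.
    rewrite !normrM (gtr0_norm t0) (ger0_norm E0) ler_wpM2r//.
    by rewrite ler_piMr ?cos_max// ltW.
  rewrite (le_trans (ler_normB _ _))// (le_trans (lerD n1 n2))//.
  by rewrite addrA -mulrDl -mulr2n mulr_natl.
rewrite /dkernel !normrM (ger0_norm (powR_ge0 _ _)) (ger0_norm (expR_ge0 _)).
apply: (@le_trans _ _ (x `^ (q - 1) * (expR (- (t * c * x `^ nu)) *
  (2 * t * x `^ nu + q / nu)))).
  by rewrite ler_wpM2l ?powR_ge0// ler_pM ?expR_ge0.
rewrite /majorant [x `^ (q - 1 + nu)]powRD; last by rewrite (gt_eqF x0) implybT.
by rewrite le_eqVlt; apply/orP; left; apply/eqP; ring.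
Qed.

Let integrable_kernel (phi : R) : 0 < cos phi -> mu.-integrable H (EFin \o kernel phi).
Proof.
move=> c0; have tc0 : 0 < t * cos phi by rewrite mulr_gt0.
have i := integrable_powR_decay nu1 tc0 qB1.
apply: (le_integrable _ _ _ i) => //.
  apply/measurable_EFinP; apply: measurable_half_line => x x0.
  have {}x0 : 0 < x by move: x0; rewrite in_itv/= andbT.
  exact: (is_derive_continuous (is_derive_mul (is_derive1_powR (q - 1) x0)
    (is_derive_mul (is_derive_decay_x phi x0)
      (is_derive_cos_comp (is_derive_phase_x phi x0))))).
move=> x _ /=; rewrite lee_fin /kernel mulrA normrM.
by rewrite ler_piMr// cos_max.
Qed.

(** Takes the place of the vanishing arcs in a contour rotation: the primitive tends to 0 at the
    origin because [q > 0], and at infinity because [cos phi > 0]. *)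
Let Rintegral_dkernel (phi : R) : 0 < cos phi -> \int[mu]_(x in H) dkernel phi x = 0.
Proof.
move=> c0.
have cd : {in `]0, +oo[, continuous (dkernel phi)}.
  move=> x; rewrite in_itv/= andbT => x0.
  have dpow := is_derive_scale (t * sin phi) (is_derive1_powR nu x0).
  have dpow' := is_derive_add (is_derive_scale (t * cos phi) (is_derive1_powR nu x0))
    (is_derive_cst (- (q / nu)) x 1).
  exact: (is_derive_continuous (is_derive_mul (is_derive1_powR (q - 1) x0)
    (is_derive_mul (is_derive_decay_x phi x0) (is_derive_add
      (is_derive_mul dpow (is_derive_cos_comp (is_derive_phase_x phi x0)))
      (is_derive_opp (is_derive_mul dpow'
        (is_derive_sin_comp (is_derive_phase_x phi x0)))))))).
have id : mu.-integrable H (EFin \o dkernel phi).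
  apply: (le_integrable _ _ _ (integrable_majorant c0)) => //.
    by apply/measurable_EFinP; exact: measurable_half_line.
  move=> x /half_lineE x0 /=; rewrite lee_fin (ger0_norm (majorant_ge0 _ _)).
  exact: norm_dkernel_le.
by rewrite (Rintegral_half_line_FTC cd id (is_derive_primitive phi)
  (cvg0_primitive c0) (cvgy_primitive c0)) subr0.
Qed.

Lemma rotated_moment (phi : R) : 0 <= phi < pi / 2 ->
  \int[mu]_(x in H) (x `^ (q - 1) * (expR (- (t * cos phi * x `^ nu)) *
    cos (t * sin phi * x `^ nu - q / nu * phi + delta))) =
  \int[mu]_(x in H) (x `^ (q - 1) * expR (- (t * x `^ nu))) * cos delta.
Proof.
move=> /andP[phi0 phi_pi].
have -> : \int[mu]_(x in H) (x `^ (q - 1) * expR (- (t * x `^ nu))) * cos delta =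
    \int[mu]_(x in H) kernel 0 x.
  rewrite -RintegralZr//; last first.
    exact: integrable_powR_decay.
  apply: eq_Rintegral => x _.
  by rewrite /kernel /decay /phase sin0 cos0 !(mulr1, mulr0, mul0r) subr0 add0r mulrA.
pose I (phi : R) := \int[mu]_(x in H) kernel phi x.
rewrite -/(I phi) -/(I 0).
move: phi0; rewrite le_eqVlt => /predU1P[<-//|phi0].
(* Strictly between [phi] and [pi / 2], so that []-b, b[] is an open neighbourhood of [[0, phi]] on
   which the cosine stays above [cos b > 0]. *)
pose b := (phi + pi / 2) / 2.
have phib : phi < b by rewrite /b; lra.
have b0 : 0 < b by exact: lt_trans phib.
have bpi : b < pi / 2 by rewrite /b; lra.
have cb0 : 0 < cos b by apply: cos_gt0_pihalf; apply/andP; split; lra.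
have cosb x : `](- b), b[%classic x -> cos b <= cos x.
  rewrite /= in_itv/= -ltr_norml => xb; rewrite -(cos_norm x) leNgt ltr_cos.
  - by rewrite -leNgt ltW.
  - by rewrite in_itv/=; apply/andP; split; lra.
  - by rewrite in_itv/= normr_ge0/=; lra.
have cos0 x : `](- b), b[%classic x -> 0 < cos x.
  by move/cosb; exact: lt_le_trans.
have dI a : `](- b), b[%classic a ->
    is_derive a 1 I 0.
  move=> Ia.
  have ik x : `](- b), b[%classic x -> mu.-integrable H (EFin \o kernel x).
    by move/cos0; exact: integrable_kernel.
  have dk (x y : R) : `](- b), b[%classic x -> H y -> derivable (kernel ^~ y) x 1.
    by move=> _ _; exact: (@ex_derive _ _ _ _ _ _ _ (is_derive_kernel_phi x y)).
  have dkE (x y : R) : partial1of2 kernel x y = dkernel x y.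
    by rewrite partial1of2E; exact: (@derive_val _ _ _ _ _ _ _ (is_derive_kernel_phi x y)).
  have dkle (x y : R) : `](- b), b[%classic x -> H y ->
      `|partial1of2 kernel x y| <= majorant (cos b) y.
    move=> /cosb cx /half_lineE y0; rewrite dkE; exact: norm_dkernel_le.
  have ig := integrable_majorant cb0.
  apply: DeriveDef.
    exact: (derivable_under_integral _ Ia ik dk (majorant_ge0 _) ig dkle).
  rewrite -derive1E.
  rewrite (differentiation_under_integral _ Ia ik dk (majorant_ge0 _) ig dkle)//.
  under eq_Rintegral do rewrite dkE.
  by apply: Rintegral_dkernel; exact: cos0.
have sub x : 0 <= x <= phi -> `](- b), b[%classic x.
  by move=> /andP[x0 xphi]; rewrite /= in_itv/=; apply/andP; split; lra.
have dI' x : x \in `]0, phi[ -> is_derive x 1 I 0.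
  by rewrite in_itv/= => /andP[x0 xphi]; apply/dI/sub; rewrite !ltW.
have cI : {within `[0, phi], continuous I}.
  apply: continuous_in_subspaceT => x /set_mem; rewrite /= in_itv/= => /sub/dI.
  exact: is_derive_continuous.
have [c _] := MVT phi0 dI' cI.
by rewrite mul0r => /eqP; rewrite subr_eq0 => /eqP.
Qed.

End rotated_moments.

(** * Unrotated moments as Gamma values *)

Section gamma_moments.
Context {R : realType}.
Notation mu := (@lebesgue_measure R).
Notation H := (`]0%R, +oo[%classic : set R).

(** From [ln y < y] at [y = x / (2 r)]; the scale [2 r] makes [r ln x] cost exactly half of the
    exponent. *)
Lemma powR_expRN_le (r x : R) : 0 < r -> 0 < x ->
  x `^ r * expR (- x) <= (2 * r) `^ r * expR (- (2^-1 * x)).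
Proof.
move=> r0 x0; have r20 : 0 < 2 * r by rewrite mulr_gt0.
rewrite !powR_expR_ln// -!expRD ler_expR.
have lnx : ln x < ln (2 * r) + x / (2 * r).
  rewrite -ltrBlDl -ln_div ?posrE// ln_sublinear// divr_gt0//.
have : r * ln x <= r * (ln (2 * r) + x / (2 * r)) by rewrite ler_pM2l// ltW.
have -> : r * (ln (2 * r) + x / (2 * r)) = r * ln (2 * r) + 2^-1 * x.
  by field; exact: lt0r_neq0.
lra.
Qed.

Lemma integrable_powR_expRN (r : R) : 0 < r ->
  mu.-integrable H (EFin \o (fun x => x `^ r * expR (- x))).
Proof.
move=> r0; have mH : measurable (H : set (measurableTypeR R)) by [].
have h0 : 0 < 2^-1 :> R by rewrite invr_gt0.
have ig := integrableZl mH ((2 * r) `^ r) (integrable_expRN h0).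
apply: (le_integrable _ _ _ ig) => //.
  apply/measurable_EFinP; apply: measurable_half_line => x x0.
  have {}x0 : 0 < x by move: x0; rewrite in_itv/= andbT.
  exact: (is_derive_continuous (is_derive_mul (is_derive1_powR r x0)
    (is_derive_expR_comp (is_derive_opp (is_derive_id x 1))))).
move=> x /half_lineE x0 /=.
rewrite lee_fin ger0_norm ?mulr_ge0 ?powR_ge0 ?expR_ge0//.
by rewrite (le_trans (powR_expRN_le r0 x0))// ler_norm.
Qed.

Variables (nu t q : R).
Hypotheses (nu1 : 1 < nu) (t0 : 0 < t) (q1 : 1 <= q).

Let nu0 : 0 < nu. Proof. exact: lt_trans nu1. Qed.
Let q0 : 0 < q. Proof. exact: lt_le_trans q1. Qed.

Let S (x : R) := t * x `^ nu.
Let dS (x : R) := t * (nu * x `^ (nu - 1)).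
Let G (x : R) := x `^ (q / nu) * expR (- x).

Let is_derive_S (x : R) : 0 < x -> is_derive x 1 S (dS x).
Proof. by move=> x0; exact: (is_derive_scale t (is_derive1_powR nu x0)). Qed.

Let continuous_dS (x : R) : 0 < x -> {for x, continuous dS}.
Proof.
move=> x0; exact: (is_derive_continuous (is_derive_scale t
  (is_derive_scale nu (is_derive1_powR (nu - 1) x0)))).
Qed.

Let derive_S (x : R) : 0 < x -> derive1 S x = dS x.
Proof.
by move=> x0; rewrite derive1E; exact: (@derive_val _ _ _ _ _ _ _ (is_derive_S x0)).
Qed.

Let continuous_derive_S (x : R) : 0 < x -> {for x, continuous (derive1 S)}.
Proof.
move=> x0; rewrite /prop_for /continuous_at derive_S//.
apply: cvg_trans (continuous_dS x0); apply: near_eq_cvg.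
near=> y; apply/esym/derive_S; near: y; exact: lt_nbhsr.
Unshelve. all: by end_near. Qed.

Let S_lt (x y : R) : 0 < x -> x < y -> S x < S y.
Proof.
move=> x0 xy; rewrite /S ltr_pM2l// gt0_ltr_powR// ?nnegrE ltW//.
exact: lt_trans xy.
Qed.

Let substitution (x : R) : 0 < x ->
  G (S x) * dS x = t `^ (q / nu) * (t * nu) * (x `^ (q - 1 + nu) * expR (- S x)).
Proof.
move=> x0; rewrite /G /dS {1}/S powRM ?powR_ge0 ?ltW//.
rewrite -(powRrM x) [nu * (q / nu)]mulrC divfK ?gt_eqF//.
have -> : q - 1 + nu = q + (nu - 1) by ring.
rewrite [x `^ (q + (nu - 1))]powRD; last by rewrite (gt_eqF x0) implybT.
by ring.
Qed.

Let cvg_S_invn : S n.+2%:R^-1 @[n --> \oo] --> 0.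
Proof.
have h : S x @[x --> 0^'+] --> 0.
  by have := cvgM (cvg_cst t) (powR_cvg0 nu0); rewrite mulr0; exact.
move/cvg_at_rightP : h; apply; split => [n|]; last exact: cvg_invn.
by have /andP[] := @invn_bounds R n.
Qed.

Let cvg_S_natr : S n.+2%:R @[n --> \oo] --> +oo.
Proof.
apply/cvgryPge => A; near=> n.
have n1 : 1 <= n.+2%:R :> R by rewrite ler1n.
apply: (@le_trans _ _ (t * n.+2%:R)); last first.
  by rewrite ler_pM2l// le1r_powR// ltW.
rewrite mulrC -ler_pdivrMr//; near: n.
exact: (proj1 (@cvgryPge _ _ _ _ _) cvg_natrS2).
Unshelve. all: by end_near. Qed.

(** The change of variable [y = t x^nu] is made between [1/(n+2)] and [n+2] and passed to the limit.
    The Jacobian raises the exponent to [q - 1 + nu] instead of the desired [q - 1]. *)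
Lemma Gamma_substitution : Gamma (1 + q / nu) =
  t `^ (q / nu) * (t * nu) *
  \int[mu]_(x in H) (x `^ (q - 1 + nu) * expR (- (t * x `^ nu))).
Proof.
have qnu : 0 < q / nu by rewrite divr_gt0.
have qnu' : 0 <= q - 1 + nu by rewrite addr_ge0 ?subr_ge0// ltW.
have iS := integrable_powR_decay nu1 t0 qnu'.
rewrite /Gamma [1 + q / nu]addrC addrK -RintegralZl//.
have iG := integrable_powR_expRN qnu.
have mH : measurable (H : set (measurableTypeR R)) by [].
have iS' := integrableZl mH (t `^ (q / nu) * (t * nu)) iS.
have inv0 n : 0 < n.+2%:R^-1 :> R by have /andP[] := @invn_bounds R n.
have S0 n : 0 < S n.+2%:R^-1 by rewrite /S mulr_gt0// powR_gt0.
have cG : \int[mu]_(x in `[S n.+2%:R^-1, S n.+2%:R]) G x @[n --> \oo] -->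
    \int[mu]_(x in H) G x := cvg_Rintegral_half_line iG S0 cvg_S_invn cvg_S_natr.
have cS := cvg_Rintegral_half_line iS' inv0 cvg_invn cvg_natrS2.
suff E n : \int[mu]_(x in `[S n.+2%:R^-1, S n.+2%:R]) G x =
    \int[mu]_(x in `[n.+2%:R^-1, n.+2%:R])
      (t `^ (q / nu) * (t * nu) * (x `^ (q - 1 + nu) * expR (- (t * x `^ nu)))).
  by rewrite (eq_cvg _ _ E) in cG; exact: (cvg_unique _ cG cS).
have /andP[_ ab] := @invn_bounds R n.
have pos x : x \in `[n.+2%:R^-1, n.+2%:R] -> 0 < x.
  by rewrite in_itv/= => /andP[+ _]; exact: lt_le_trans.
rewrite {1}/Rintegral integration_by_substitution_increasing//.
- congr fine; apply: eq_integral => x /set_mem xab; congr EFin.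
  rewrite -[LHS]/(G (S x) * derive1 S x) derive_S ?substitution//; exact: pos.
- exact: ltW.
- by move=> x y /pos x0 _; exact: S_lt.
- by move=> x /subset_itv_oo_cc /pos; exact: continuous_derive_S.
- apply: cvgP; apply: cvg_at_right_filter.
  exact: continuous_derive_S.
- apply: cvgP; apply: cvg_at_left_filter.
  exact: continuous_derive_S.
- split.
  + move=> x /subset_itv_oo_cc /pos x0.
    exact: (@ex_derive _ _ _ _ _ _ _ (is_derive_S x0)).
  + apply: cvg_at_right_filter.
    exact: (is_derive_continuous (is_derive_S (inv0 n))).
  + apply: cvg_at_left_filter.
    exact: (is_derive_continuous (is_derive_S (lt_trans (inv0 n) ab))).
- apply: continuous_in_subspaceT => x /set_mem; rewrite /= in_itv/= => /andP[Sx _].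
  have x0 : 0 < x by exact: lt_le_trans Sx.
  exact: (is_derive_continuous (is_derive_mul (is_derive1_powR (q / nu) x0)
    (is_derive_expR_comp (is_derive_opp (is_derive_id x 1))))).
Qed.

(** Integrating the derivative of [x^q e^(- t x^nu)], which vanishes at both ends, brings the
    exponent [q - 1 + nu] down to [q - 1]. This does the work of the functional equation of
    Gamma. *)
Lemma stretched_exponential_moment :
  \int[mu]_(x in H) (x `^ (q - 1) * expR (- (t * x `^ nu))) =
  Gamma (1 + q / nu) / (q * t `^ (q / nu)).
Proof.
have qB1 : 0 <= q - 1 by rewrite subr_ge0.
have qnu' : 0 <= q - 1 + nu by rewrite addr_ge0// ltW.
have i1 := integrable_powR_decay nu1 t0 qB1.
have i2 := integrable_powR_decay nu1 t0 qnu'.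
have mH : measurable (H : set (measurableTypeR R)) by [].
have i1' := integrableZl mH q i1.
have i2' := integrableZl mH (t * nu) i2.
pose f (x : R) := q * (x `^ (q - 1) * expR (- (t * x `^ nu))) -
  t * nu * (x `^ (q - 1 + nu) * expR (- (t * x `^ nu))).
have dF (x : R) : 0 < x ->
    is_derive x 1 (fun x => x `^ q * expR (- (t * x `^ nu))) (f x).
  move=> x0; apply: (is_derive_val (is_derive_mul (is_derive1_powR q x0)
    (is_derive_expR_comp (is_derive_opp (is_derive_S x0))))).
  rewrite /f /dS /S (_ : q - 1 + nu = q + (nu - 1)); last by ring.
  rewrite [x `^ (q + (nu - 1))]powRD; last by rewrite (gt_eqF x0) implybT.
  by ring.
have cf : {in `]0, +oo[, continuous f}.
  move=> x; rewrite in_itv/= andbT => x0.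
  have dexp := is_derive_expR_comp (is_derive_opp (is_derive_S x0)).
  exact: (is_derive_continuous (is_derive_add
    (is_derive_scale q (is_derive_mul (is_derive1_powR (q - 1) x0) dexp))
    (is_derive_opp (is_derive_scale (t * nu)
      (is_derive_mul (is_derive1_powR (q - 1 + nu) x0) dexp))))).
have iF : mu.-integrable H (EFin \o f) := integrableB mH i1' i2'.
have F0 : x `^ q * expR (- (t * x `^ nu)) @[x --> 0^'+] --> 0.
  apply: (@cvg0_bounded_mul _ _ _ _ _ _ 1 (powR_cvg0 q0)) => x.
  rewrite ger0_norm ?expR_ge0// -expR0 ler_expR oppr_le0.
  by rewrite mulr_ge0 ?powR_ge0// ltW.
have := Rintegral_half_line_FTC cf iF dF F0 (cvgy_stretched_exponential nu1 t0 (ltW q0)).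
rewrite RintegralB// !RintegralZl// Gamma_substitution subr0 => /eqP.
rewrite subr_eq0 => /eqP E.
rewrite -[_ * (t * nu) * _]mulrA -E; field.
by rewrite !gt_eqF ?powR_gt0.
Qed.

End gamma_moments.

(** * The series *)

Section cosine_expansion.
Context {R : realType}.
Notation mu := (@lebesgue_measure R).
Notation H := (`]0%R, +oo[%classic : set R).

(** A Taylor term of [cos (w + y)] in [y]: each derivative of the cosine is a shift by [pi / 2].
    Keeping a single shifted cosine, instead of separate even and odd terms, gives every coefficient
    the shape of a rotated moment. *)
Definition cos_taylor (w y : R) (k : nat) : R :=
  y ^+ k / k`!%:R * cos (w + k%:R * (pi / 2)).

(** The parity factors are those of [cos_coeff] and [sin_coeff], so the Taylor series splits along
    the addition formula; the induction goes by steps of two, each a shift by [pi]. *)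
Lemma cos_add_pihalf_natmul (w : R) (k : nat) : cos (w + k%:R * (pi / 2)) =
  (~~ odd k)%:R * (-1) ^+ k./2 * cos w - (odd k)%:R * (-1) ^+ k.-1./2 * sin w.
Proof.
have [n] := ubnP k; elim: n k => // n IHn [|[|k]] kn.
- by rewrite mul0r addr0 /=; ring.
- by rewrite mul1r cosDpihalf /=; ring.
- have -> : w + k.+2%:R * (pi / 2) = w + k%:R * (pi / 2) + pi.
    by rewrite -addn2 natrD; field.
  rewrite cosDpi IHn; last by rewrite -ltnS ltnW.
  case: k {kn} => [|k] /=; first by ring.
  by rewrite !negbK !exprS; case: (odd k) => /=; ring.
Qed.

Lemma cos_taylorE (w y : R) :
  cos_taylor w y = (fun k => cos w * cos_coeff y k - sin w * sin_coeff y k).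
Proof.
apply/funext => k; rewrite /cos_taylor cos_add_pihalf_natmul.
by rewrite /cos_coeff /sin_coeff /= -!exprnP; ring.
Qed.

Lemma cvg_cos_taylor (w y : R) : series (cos_taylor w y) @ \oo --> cos (y + w).
Proof.
have -> : series (cos_taylor w y) = (fun n =>
    cos w * series (cos_coeff y) n - sin w * series (sin_coeff y) n).
  apply/funext => n; rewrite cos_taylorE /series/= !mulr_sumr -sumrB.
  exact: eq_bigr.
rewrite cosD [cos y * _]mulrC [sin y * _]mulrC.
have cC : series (cos_coeff y) @ \oo --> cos y.
  have -> : cos y = lim (series (cos_coeff y) @ \oo) by rewrite cos.unlock.
  exact: is_cvg_series_cos_coeff.
have cS : series (sin_coeff y) @ \oo --> sin y.
  have -> : sin y = lim (series (sin_coeff y) @ \oo) by rewrite sin.unlock.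
  exact: is_cvg_series_sin_coeff.
exact: (cvgB (cvgM (cvg_cst (cos w)) cC) (cvgM (cvg_cst (sin w)) cS)).
Qed.

Lemma norm_series_cos_taylor_le (w y : R) (n : nat) :
  `|series (cos_taylor w y) n| <= expR `|y|.
Proof.
apply: (@le_trans _ _ (series (exp_coeff `|y|) n)).
  rewrite /series/= (le_trans (ler_norm_sum _ _ _))//.
  apply: ler_sum => k _; rewrite /cos_taylor /exp_coeff/= !normrM normrX.
  by rewrite [`|_^-1|]ger0_norm ?invr_ge0// ler_piMr ?cos_max// divr_ge0// exprn_ge0.
have -> : expR `|y| = limn (series (exp_coeff `|y|)) by [].
apply: nondecreasing_cvgn_le; last exact: is_cvg_series_exp_coeff.
by apply: nondecreasing_series => k _ _; rewrite /exp_coeff/= divr_ge0// exprn_ge0.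
Qed.

Variables (u w : R -> R) (x : R).
Hypotheses (mfu : measurable_fun H u) (mw : measurable_fun H w)
  (iu : mu.-integrable H (EFin \o (fun g => u g * expR (`|x| * g)))).

Let norm_le (g : R) (n : nat) : H g ->
  `|u g * series (cos_taylor (w g) (g * x)) n| <= `|u g * expR (`|x| * g)|.
Proof.
move=> /half_lineE g0; rewrite !normrM ler_wpM2l// [leRHS]ger0_norm ?expR_ge0//.
rewrite (le_trans (norm_series_cos_taylor_le _ _ _))//.
by rewrite normrM (gtr0_norm g0) mulrC.
Qed.

Let measurable_term (k : nat) :
  measurable_fun H (fun g => u g * cos_taylor (w g) (g * x) k).
Proof.
apply: measurable_funM => //; apply: measurable_funM.
  apply: measurable_funM => //; apply: measurable_funX.
  exact: measurable_funM.
apply: (measurableT_comp (f := cos)); last exact: measurable_funD.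
by apply: continuous_measurable_fun; exact: continuous_cos.
Qed.

Let seriesE (g : R) (n : nat) : u g * series (cos_taylor (w g) (g * x)) n.+1 =
  u g * series (cos_taylor (w g) (g * x)) n + u g * cos_taylor (w g) (g * x) n.
Proof. by rewrite /series/= big_nat_recr//= mulrDr. Qed.

Let integrable_partial (n : nat) :
  mu.-integrable H (EFin \o (fun g => u g * series (cos_taylor (w g) (g * x)) n)).
Proof.
apply: (le_integrable _ _ _ iu) => //; last first.
  by move=> g Hg /=; rewrite lee_fin norm_le.
apply/measurable_EFinP; elim: n => [|n IHn].
  rewrite (_ : (fun g => _) = cst 0)//; apply/funext => g.
  by rewrite /series/= big_geq// mulr0.
rewrite (_ : (fun g => _) = (fun g => u g * series (cos_taylor (w g) (g * x)) n +
  u g * cos_taylor (w g) (g * x) n)); first exact: (measurable_funD IHn (measurable_term n)).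
by apply/funext => g; exact: seriesE.
Qed.

Let integrable_term (k : nat) :
  mu.-integrable H (EFin \o (fun g => u g * cos_taylor (w g) (g * x) k)).
Proof.
have mH : measurable (H : set (measurableTypeR R)) by [].
apply: eq_integrable (integrableB mH (integrable_partial k.+1) (integrable_partial k)) => //.
by move=> g _ /=; rewrite -EFinB seriesE addrC addKr.
Qed.

Lemma cvg_Rintegral_cos_expansion :
  series (fun k => \int[mu]_(g in H) (u g * cos_taylor (w g) (g * x) k)) @ \oo -->
  \int[mu]_(g in H) (u g * cos (g * x + w g)).
Proof.
have -> : series (fun k => \int[mu]_(g in H) (u g * cos_taylor (w g) (g * x) k)) =
    (fun n => \int[mu]_(g in H) (u g * series (cos_taylor (w g) (g * x)) n)).
  apply/funext => n; elim: n => [|n IHn].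
    rewrite /series/= big_geq//; under eq_Rintegral do rewrite big_geq// mulr0.
    by rewrite Rintegral_cst// mul0r.
  under [RHS]eq_Rintegral do rewrite seriesE.
  by rewrite RintegralD// -IHn /series/= big_nat_recr.
apply: (@cvg_Rintegral_dominated _ _ _ mu H
  (fun n g => u g * series (cos_taylor (w g) (g * x)) n) _
  (fun g => `|u g * expR (`|x| * g)|)) => //.
- by move=> n; apply/measurable_EFinP; exact: measurable_int (integrable_partial n).
- apply: measurable_funM => //; apply: (measurableT_comp (f := cos)).
    by apply: continuous_measurable_fun; exact: continuous_cos.
  by apply: measurable_funD => //; exact: measurable_funM.
- apply: aeW => g _; apply: cvgM; first exact: cvg_cst.
  exact: cvg_cos_taylor.
- exact: integrable_norm.
- by move=> n g; exact: norm_le.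
Qed.

End cosine_expansion.

(** * Stable densities *)

Section char_fun_density.
Context d (T : measurableType d) (R : realType) (P : probability T R).
Variable X : {RV P >-> R}.
Notation mu := (@lebesgue_measure R).
Notation H := (`]0%R, +oo[%classic : set R).

Lemma char_funE (g : R) :
  char_fun X g = ((\int[P]_w cos (g * X w)) +i* (\int[P]_w sin (g * X w)))%C.
Proof. by rewrite /char_fun unlock. Qed.

Lemma continuous_pdf_char_fun (u v : R -> R) :
  mu.-integrable H (EFin \o u) -> mu.-integrable H (EFin \o v) ->
  (forall g, 0 < g -> char_fun X g = (u g +i* v g)%C) ->
  continuous_pdf X (fun a => pi^-1 * half_fourier u v a).
Proof.
move=> iu iv uvE.
have uE g : H g -> \int[P]_w cos (g * X w) = u g.
  by move=> /half_lineE /uvE; rewrite char_funE => -[].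
have vE g : H g -> \int[P]_w sin (g * X w) = v g.
  by move=> /half_lineE /uvE; rewrite char_funE => -[].
have iu' : mu.-integrable H (EFin \o (fun g => \int[P]_w cos (g * X w))).
  by apply: (eq_integrable _ _ _ _ iu) => // g /set_mem Hg /=; rewrite uE.
have iv' : mu.-integrable H (EFin \o (fun g => \int[P]_w sin (g * X w))).
  by apply: (eq_integrable _ _ _ _ iv) => // g /set_mem Hg /=; rewrite vE.
have := fourier_inversion_pdf iu' iv'.
congr (continuous_pdf X _); apply/funext => a; congr (_ * _).
by apply: eq_Rintegral => g /set_mem Hg; rewrite uE// vE.
Qed.

End char_fun_density.

(** Converts the phase left by the rotation into the alternating sign and the sine of the series. *)
Lemma cos_natmul_pi_sub (R : realType) (y : R) (m : nat) :
  cos (m%:R * pi - y - pi / 2) = - ((-1) ^+ m * sin y).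
Proof.
rewrite cosBpihalf -(mulrN1 (_ * _)) -mulrA -[sin y * -1]mulrC mulN1r -sinN.
by rewrite -(alternatingn (@sinDpi R)) mulr_natl addrC.
Qed.

Section stable_density.
Context {R : realType}.
Notation mu := (@lebesgue_measure R).
Notation H := (`]0%R, +oo[%classic : set R).
Variables (nu phi : R).
Hypotheses (nu1 : 1 < nu) (phi0 : 0 <= phi) (phi_lt : phi < pi / 2).

Let cphi0 : 0 < cos phi.
Proof.
apply: cos_gt0_pihalf; rewrite phi_lt andbT (lt_le_trans _ phi0)//.
by rewrite oppr_lt0 divr_gt0// pi_gt0.
Qed.

Definition stable_cf_re (t g : R) : R :=
  expR (- (t * cos phi * g `^ nu)) * cos (t * sin phi * g `^ nu).

Definition stable_cf_im (t g : R) : R :=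
  - (expR (- (t * cos phi * g `^ nu)) * sin (t * sin phi * g `^ nu)).

Definition stable_pdf (x t : R) : R :=
  pi^-1 * half_fourier (stable_cf_re t) (stable_cf_im t) x.

Let continuous_powR_scale (a g : R) : 0 < g -> {for g, continuous (fun g => a * g `^ nu)}.
Proof.
by move=> g0; exact: (is_derive_continuous (is_derive_scale a (is_derive1_powR nu g0))).
Qed.

Let measurable_powR_scale (a : R) : measurable_fun H (fun g => a * g `^ nu).
Proof.
apply: measurable_half_line => g; rewrite in_itv/= andbT.
exact: continuous_powR_scale.
Qed.

Let measurable_decay (a : R) : measurable_fun H (fun g => expR (- (a * g `^ nu))).
Proof.
apply: (measurableT_comp (f := expR)) => //.
by apply: measurableT_comp => //; exact: measurable_powR_scale.
Qed.

Let integrable_decay (t : R) : 0 < t ->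
  mu.-integrable H (EFin \o (fun g => expR (- (t * cos phi * g `^ nu)))).
Proof.
move=> t0; have tc0 : 0 < t * cos phi by rewrite mulr_gt0.
have := integrable_powR_decay nu1 tc0 (lexx 0).
by apply: eq_integrable => // g _ /=; rewrite powRr0 mul1r.
Qed.

Lemma integrable_stable_cf_re (t : R) : 0 < t ->
  mu.-integrable H (EFin \o stable_cf_re t).
Proof.
move=> t0; apply: (le_integrable _ _ _ (integrable_decay t0)) => //.
  apply/measurable_EFinP; apply: measurable_funM.
    exact: measurable_decay.
  apply: (measurableT_comp (f := cos)); last exact: measurable_powR_scale.
  by apply: continuous_measurable_fun; exact: continuous_cos.
by move=> g _ /=; rewrite lee_fin normrM ler_piMr// cos_max.
Qed.

Lemma integrable_stable_cf_im (t : R) : 0 < t ->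
  mu.-integrable H (EFin \o stable_cf_im t).
Proof.
move=> t0; apply: (le_integrable _ _ _ (integrable_decay t0)) => //.
  apply/measurable_EFinP; apply: measurableT_comp => //; apply: measurable_funM.
    exact: measurable_decay.
  apply: (measurableT_comp (f := sin)); last exact: measurable_powR_scale.
  by apply: continuous_measurable_fun; exact: continuous_sin.
by move=> g _ /=; rewrite lee_fin normrN normrM ler_piMr// sin_max.
Qed.

(** Reflection in [x] conjugates the transform, so the reflected density is the one attached to the
    opposite skewness. *)
Lemma stable_pdfN (x t : R) :
  stable_pdf (- x) t = pi^-1 * half_fourier (stable_cf_re t) (fun g => - stable_cf_im t g) x.
Proof.
congr (_ * _); apply: eq_Rintegral => g _.
by rewrite mulrN cosN sinN; ring.
Qed.

Lemma stable_pdfE (x t : R) : stable_pdf x t = pi^-1 * \int[mu]_(g in H)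
  (expR (- (t * cos phi * g `^ nu)) * cos (g * x + t * sin phi * g `^ nu)).
Proof.
congr (_ * _); apply: eq_Rintegral => g _.
by rewrite /stable_cf_re /stable_cf_im cosD; ring.
Qed.

(** The coefficient of [x^k] is the moment with [q = k+1]. The factor [- x] raises the power to
    [k+1], which shifts the index of the series, and the [1 / q] of the moment completes [k!] to
    [(k+1)!]. *)
Lemma stable_pdf_term (x t : R) (k : nat) : 0 < t ->
  - x * \int[mu]_(g in H) (expR (- (t * cos phi * g `^ nu)) *
    cos_taylor (t * sin phi * g `^ nu) (g * x) k) =
  1 / k.+1`!%:R * sin (k.+1%:R * (pi / 2 - phi / nu)) *
    Gamma (1 + k.+1%:R / nu) * (- (x / t `^ (1 / nu))) ^+ k.+1.
Proof.
move=> t0; have nu0 : 0 < nu by exact: lt_trans nu1.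
have q1 : 1 <= k.+1%:R :> R by rewrite ler1n.
(* The Taylor shift plus a term cancelling the [- q / nu * phi] built into the rotated moment. *)
pose delta : R := k%:R * (pi / 2) + k.+1%:R / nu * phi.
have tc0 : 0 < t * cos phi by rewrite mulr_gt0.
have kB1 : k.+1%:R - 1 = k%:R :> R by rewrite -natr1 addrK.
pose f (g : R) := g `^ (k.+1%:R - 1) * (expR (- (t * cos phi * g `^ nu)) *
  cos (t * sin phi * g `^ nu - k.+1%:R / nu * phi + delta)).
have intf : mu.-integrable H (EFin \o f).
  have qB1 : 0 <= k.+1%:R - 1 :> R by rewrite kB1.
  apply: (le_integrable _ _ _ (integrable_powR_decay nu1 tc0 qB1)) => //.
    apply/measurable_EFinP; apply: measurable_funM.
      apply: measurable_half_line; exact: in_continuous_powR.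
    apply: measurable_funM; first exact: measurable_decay.
    apply: (measurableT_comp (f := cos)).
      by apply: continuous_measurable_fun; exact: continuous_cos.
    apply: measurable_funD => //; apply: measurable_funB => //.
    exact: measurable_powR_scale.
  by move=> g _ /=; rewrite lee_fin /f mulrA normrM ler_piMr// cos_max.
have -> : \int[mu]_(g in H) (expR (- (t * cos phi * g `^ nu)) *
    cos_taylor (t * sin phi * g `^ nu) (g * x) k) =
    x ^+ k / k`!%:R * \int[mu]_(g in H) f g.
  rewrite -RintegralZl//; apply: eq_Rintegral => g /set_mem /half_lineE g0.
  rewrite /f /cos_taylor kB1 powR_mulrn ?ltW// exprMn.
  rewrite (_ : _ - _ + delta = t * sin phi * g `^ nu + k%:R * (pi / 2)).
    by ring.
  by rewrite /delta; ring.
rewrite rotated_moment ?phi0 ?phi_lt// stretched_exponential_moment//.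
have -> : cos delta = - ((-1) ^+ k.+1 * sin (k.+1%:R * (pi / 2 - phi / nu))).
  rewrite -cos_natmul_pi_sub; congr cos; rewrite /delta -natr1.
  by field; exact: lt0r_neq0.
have -> : t `^ (k.+1%:R / nu) = (t `^ (1 / nu)) ^+ k.+1.
  by rewrite -powR_mulrn ?powR_ge0// -powRrM mulrC div1r.
have tp : t `^ (1 / nu) != 0 by rewrite gt_eqF// powR_gt0.
rewrite factS natrM -[- (x / _)]mulN1r !exprMn exprVn.
rewrite [x ^+ k.+1]exprS; field.
by rewrite expf_neq0// pnatr_eq0 -lt0n fact_gt0 addrC natr1 pnatr_eq0.
Qed.

Lemma cvg_stable_pdf_series (x t : R) : 0 < t ->
  \sum_(1 <= k < n.+1) (1 / k`!%:R * sin (k%:R * (pi / 2 - phi / nu)) *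
    Gamma (1 + k%:R / nu) * (- (x / t `^ (1 / nu))) ^+ k) @[n --> \oo] -->
  - x * (pi * stable_pdf x t).
Proof.
move=> t0; have tc0 : 0 < t * cos phi by rewrite mulr_gt0.
have E n : \sum_(1 <= k < n.+1) (1 / k`!%:R * sin (k%:R * (pi / 2 - phi / nu)) *
    Gamma (1 + k%:R / nu) * (- (x / t `^ (1 / nu))) ^+ k) =
    - x * series (fun k => \int[mu]_(g in H) (expR (- (t * cos phi * g `^ nu)) *
      cos_taylor (t * sin phi * g `^ nu) (g * x) k)) n.
  rewrite big_add1/= /series/= mulr_sumr.
  by apply: eq_bigr => k _; rewrite stable_pdf_term.
rewrite (eq_cvg _ _ E); apply: cvgM; first exact: cvg_cst.
rewrite stable_pdfE mulVKf ?gt_eqF ?pi_gt0//.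
apply: cvg_Rintegral_cos_expansion => //.
have := integrable_stretched_exponential `|x| nu1 tc0 (lexx 0).
apply: eq_integrable => // g _ /=.
by rewrite powRr0 mul1r expRD mulrC.
Qed.

End stable_density.

(** * Admissible parameters and skewness *)

Section admissible_parameters.
Context {R : realType}.

Lemma tan_lt0_pihalf_pi (x : R) : pi / 2 < x < pi -> tan x < 0.
Proof.
move=> /andP[x1 x2]; have x12 : 0 < x - pi / 2 < pi / 2.
  by rewrite subr_gt0 x1 /= ltrBlDr -splitr.
have cx : cos x < 0.
  by rewrite -[x](subrK (pi / 2)) cosDpihalf oppr_lt0 sin_gt0_pihalf.
have sx : 0 < sin x.
  by rewrite sin_gt0_pi// x2 andbT (lt_trans _ x1)// divr_gt0// pi_gt0.
by rewrite /tan pmulr_rlt0// invr_lt0.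
Qed.

Lemma tan_stable_lt0 (nu : R) : 1 < nu -> nu < 2 -> tan (pi * nu / 2) < 0.
Proof.
move=> nu1 nu2; apply: tan_lt0_pihalf_pi; have pi0 := pi_gt0 R.
apply/andP; split.
  by rewrite ltr_pM2r ?invr_gt0// ltr_pMr.
by rewrite -mulrA gtr_pMr// ltr_pdivrMr// mul1r.
Qed.

Lemma exists_admissible (nu beta : R) : 1 < nu -> nu < 2 -> 0 < beta ->
  exists theta alpha : R, [/\ 0 < theta < 1, 1 < alpha, nu = alpha * theta &
    beta = - (tan (pi * theta / 2) / tan (pi * alpha * theta / 2))].
Proof.
move=> nu1 nu2 beta0; have pi0 := pi_gt0 R.
have T0 := tan_stable_lt0 nu1 nu2.
(* As [alpha theta = nu], the condition on [beta] reads [tan (pi theta / 2) = b]. Negativity of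
   [tan (pi nu / 2)] gives [b > 0], so the arctangent lies in []0, pi / 2[] and [theta] in []0, 1[];
   then [alpha = nu / theta > 1]. *)
pose b := - (beta * tan (pi * nu / 2)).
have b0 : 0 < b by rewrite oppr_gt0 pmulr_rlt0.
pose theta := atan b / (pi / 2).
have pih0 : 0 < pi / 2 :> R by rewrite divr_gt0.
have thetaE : pi * theta / 2 = atan b.
  by rewrite mulrAC mulrC divfK// lt0r_neq0.
have theta0 : 0 < theta by rewrite divr_gt0// -atan0 lt_atan.
have theta1 : theta < 1 by rewrite ltr_pdivrMr// mul1r atan_ltpi2.
exists theta, (nu / theta); split.
- by rewrite theta0.
- by rewrite ltr_pdivlMr// mul1r (lt_trans theta1).
- by rewrite divfK// lt0r_neq0.
- rewrite thetaE atanK -(mulrA pi (nu / theta)) divfK ?lt0r_neq0// /b mulNr mulfK ?opprK//.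
  exact: ltr0_neq0.
Qed.

Lemma stable_cf_reN (nu phi t g : R) :
  stable_cf_re nu (- phi) t g = stable_cf_re nu phi t g.
Proof. by rewrite /stable_cf_re cosN sinN mulrN mulNr cosN. Qed.

Lemma stable_cf_imN (nu phi t g : R) :
  stable_cf_im nu (- phi) t g = - stable_cf_im nu phi t g.
Proof. by rewrite /stable_cf_im cosN sinN mulrN mulNr sinN mulrN. Qed.

(** The hypothesis on [b] says [cos phi (1 - i b) = e^(i phi)]. No sign is imposed on [phi], so both
    skewnesses are covered. *)
Lemma cexp_stable (t nu phi b g : R) : 0 < g -> b * cos phi = - sin phi ->
  cexp (- (t * cos phi * `|g| `^ nu)%:C * (1 - 'i%C * (b * Num.sg g)%:C))%C =
  (stable_cf_re nu phi t g +i* stable_cf_im nu phi t g)%C.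
Proof.
move=> g0 bc; rewrite gtr0_sg// gtr0_norm// mulr1 /stable_cf_re /stable_cf_im.
set A := t * cos phi * g `^ nu.
have -> : (- A%:C * (1 - 'i * b%:C))%C = (- A +i* (A * b))%C.
  by apply/eqP; rewrite eq_complex /=; apply/andP; split; apply/eqP; ring.
have -> : A * b = - (t * sin phi * g `^ nu).
  rewrite -[sin phi]opprK -bc /A; ring.
by rewrite /cexp cosN sinN mulrN.
Qed.
End admissible_parameters.

Theorem mainTheorem5 (R : realType) (nu beta : R)
    (hnu1 : 1 < nu) (hnu2 : nu < 2) (hbeta0 : 0 < beta) (hbeta1 : beta < 1) :
  let admissible (theta alpha : R) : Prop :=
    [/\ 0 < theta < 1, 1 < alpha, nu = alpha * theta &
        beta = - (tan (pi * theta / 2) / tan (pi * alpha * theta / 2))] in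
  (exists theta alpha : R, admissible theta alpha) /\
  (forall theta alpha : R, admissible theta alpha ->
     let sigma := (cos (pi * theta / 2)) `^ (1 / nu) in
     exists p : R -> R -> R,
       [/\ (forall (d : measure_display) (T : measurableType d)
              (P : probability T R) (X : R -> {RV P >-> R}),
              stable_process nu sigma beta X ->
              forall t : R, 0 < t -> continuous_pdf (X t) (fun x => p x t)),
           (forall x t : R, 0 < t -> x != 0 ->
              let partial (n : nat) : R :=
                \sum_(1 <= k < n.+1)
                  (1 / k`!%:R * sin (k%:R * pi * ((alpha - 1) / (2 * alpha))) *
                   Gamma (1 + k%:R / (theta * alpha)) *
                   (- (x / t `^ (1 / (theta * alpha)))) ^+ k) in
              cvgn partial /\ p x t = - (1 / (pi * x)) * limn partial) &
           (forall (d : measure_display) (T : measurableType d)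
              (P : probability T R) (Y : R -> {RV P >-> R}),
              stable_process nu sigma (- beta) Y ->
              forall t : R, 0 < t -> continuous_pdf (Y t) (fun x => p (- x) t))]).
Proof.
move=> admissible; split; first exact: exists_admissible.
move=> theta alpha [/andP[theta0 theta1] alpha1 nuE betaE] sigma.
have pi0 := pi_gt0 R; have nu0 : 0 < nu by exact: lt_trans hnu1.
have alpha0 : 0 < alpha by exact: lt_trans alpha1.
set phi := pi * theta / 2 in betaE sigma *.
have phi0 : 0 < phi by rewrite divr_gt0// mulr_gt0.
have phi_ge0 := ltW phi0.
have phi_lt : phi < pi / 2 by rewrite ltr_pM2r ?invr_gt0// gtr_pMr.
have cphi0 : 0 < cos phi.
  by apply: cos_gt0_pihalf; rewrite phi_lt andbT (lt_trans _ phi0)// oppr_lt0 divr_gt0.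
have sigmaE : sigma `^ nu = cos phi.
  by rewrite -powRrM mul1r mulVf ?lt0r_neq0// powRr1// ltW.
(* The condition on [beta] with its denominators cleared; [tan (pi nu / 2)] is nonzero because it is
   negative. *)
have bc : beta * tan (pi * nu / 2) * cos phi = - sin phi.
  have := ltr0_neq0 (tan_stable_lt0 hnu1 hnu2).
  rewrite betaE -(mulrA pi alpha) -nuE => T0.
  by rewrite mulNr divfK// /tan mulNr divfK// lt0r_neq0.
(* The witness is the inversion integral: unlike the series formula, which divides by [x], it is
   defined and continuous at 0 as well. *)
exists (fun x t => stable_pdf nu phi x t); split.
- move=> d T P X stX t t0; apply: continuous_pdf_char_fun.
  + exact: integrable_stable_cf_re.
  + exact: integrable_stable_cf_im.
  + move=> g g0; rewrite (stable_char_fun stX) ?ltW// sigmaE.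
    by rewrite -(cexp_stable t nu g0 bc) [beta * _ * _]mulrAC.
- move=> x t t0 x0 partial.
  have cp : partial @ \oo --> - x * (pi * stable_pdf nu phi x t).
    have -> : partial = (fun n => \sum_(1 <= k < n.+1)
        (1 / k`!%:R * sin (k%:R * (pi / 2 - phi / nu)) *
        Gamma (1 + k%:R / nu) * (- (x / t `^ (1 / nu))) ^+ k)).
      apply/funext => n; apply: eq_bigr => k _.
      rewrite [theta * alpha]mulrC -nuE; congr (_ * sin _ * _ * _).
      (* Here [phi / nu = pi / (2 alpha)], so [pi / 2 - phi / nu = pi (alpha - 1) / (2 alpha)]. *)
      rewrite -mulrA; congr (_ * _); rewrite /phi nuE.
      by field; rewrite !lt0r_neq0.
    exact: cvg_stable_pdf_series.
  split; first exact: cvgP cp.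
  rewrite (cvg_lim _ cp)//; move: (stable_pdf _ _ _ _) (lt0r_neq0 pi0) => s.
  by move: (pi : R) => p p0; field; rewrite x0.
- move=> d T P Y stY t t0.
  under eq_fun do rewrite stable_pdfN.
  apply: continuous_pdf_char_fun.
  + exact: integrable_stable_cf_re.
  + have := integrableN (integrable_stable_cf_im hnu1 phi_ge0 phi_lt t0).
    exact.
  + move=> g g0; rewrite (stable_char_fun stY) ?ltW// sigmaE.
    (* The skewness [- beta] corresponds to the angle [- phi], with the same [sigma] because the
       cosine is even. *)
    have bcN : - beta * tan (pi * nu / 2) * cos (- phi) = - sin (- phi).
      by rewrite cosN sinN !mulNr bc.
    rewrite -[- stable_cf_im _ _ _ _]stable_cf_imN -stable_cf_reN.
    by rewrite -(cexp_stable t nu g0 bcN) cosN [- beta * _ * _]mulrAC.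
Qed.
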